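(* Let $P$ be a race-free $\pi$-calculus process. Then $P$ is deadlock-free if and only if $\vdash_{\mathsf{PiL}}[\![P]\!]$. More precisely, $P$ is deadlock-free if and only if $[\![P]\!]$ is derivable using only the rules $\{\text{Unit},\ \text{ax},\ ⅋,\ \text{mix},\ \blacktriangleleft,\ \&,\ \oplus,\ \exists,\ \mathsf{New}_\circ\}$.
   Context: **Processes.** Fix a countable set of names and a finite set of labels, disjoint from names. Processes: $P,Q::=\mathsf{Nil}\mid x!\langle y\rangle.P\mid x?(y).P\mid P\,|\,Q\mid(\nu x)P\mid x\triangleleft\{\ell:P_\ell\}_{\ell\in L}\mid x\triangleright\{\ell:P_\ell\}_{\ell\in L}$, with $x,y$ names and $L$ a nonempty set of labels. $x?(y).P$ binds $y$ in $P$ and $(\nu x)P$ binds $x$ in $P$; free names, $\alpha$-equivalence and capture-avoiding substitution $P[x/y]$ ($x$ for $y$) are standard. Processes are assumed written unambiguously: each restricted name is bound by a unique $\nu$ and does not also occur free. **Structural relations.** $\Rrightarrow$ is the closure under process contexts of: $P|Q\Rrightarrow Q|P$; $(P|Q)|R\Rrightarrow P|(Q|R)$ and conversely; $(\nu x)(\nu y)P\Rrightarrow(\nu y)(\nu x)P$; $P|\mathsf{Nil}\Rrightarrow P$; and, if $x$ is not free in $S$, $(\nu x)S\Rrightarrow S$ and $(\nu x)P\,|\,S\Rrightarrow(\nu x)(P|S)$. $\Rrightarrow^*$ is its reflexive-transitive closure; $\equiv$ is the equivalence relation generated by $\Rrightarrow$ and $\alpha$-equivalence. **Reduction $\to$.**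 Generated by - $\mathsf{Com}$: $x!\langle a\rangle.P\,|\,x?(b).Q\to P\,|\,Q[a/b]$; - $\mathsf{Choice}$: $x\triangleleft\{\ell:P_\ell\}_{\ell\in L}\to x\triangleleft\{\ell_k:P_{\ell_k}\}$ if $\ell_k\in L$; - $\mathsf{Label}$: $x\triangleleft\{\ell_k:P_{\ell_k}\}\,|\,x\triangleright\{\ell:Q_\ell\}_{\ell\in L}\to P_{\ell_k}|Q_{\ell_k}$ if $\ell_k\in L$; - $\mathsf{Res}$: $(\nu x)P\to(\nu x)P'$ if $P\to P'$; $\mathsf{Par}$: $P|Q\to P'|Q$ if $P\to P'$; - $\mathsf{Struc}$: $P\to Q$ if $P\Rrightarrow^*P'=\mathcal P[S]\to\mathcal P[S']=Q$ for a process context $\mathcal P[\bullet]$ (a process with one hole), with $P\neq P'$ and $S\to S'$ not via $\mathsf{Struc}$. Let $\to^*$ be the reflexive-transitive closure of $\to$. $P$ is *stuck* if $P\not\equiv\mathsf{Nil}$ and there is no $P'$ with $P\to P'$. $P$ is *deadlock-free* if there is no stuck $P'$ with $P\to^*P'$. **Races.** A network context is $\mathcal N[\bullet]=(\nu x_1)\cdots(\nu x_k)(\bullet\,|\,P_1|\cdots|P_n)$. $P$ has a *race condition* if, for some network context $\mathcal N$, $P$ is $\equiv$ to a process of one of the shapes $\mathcal N[x!\langle y\rangle.R\,|\,x!\langle z\rangle.Q]$, $\mathcal N[x?(y).R\,|\,x?(z).Q]$, $\mathcal N[x\triangleleft\{\ell:R_\ell\}_{\ell\in L}\,|\,x\triangleleft\{\ell:Q_\ell\}_{\ell\in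 L'}]$, $\mathcal N[x\triangleright\{\ell:R_\ell\}_{\ell\in L}\,|\,x\triangleright\{\ell:Q_\ell\}_{\ell\in L'}]$. $P$ is *race-free* if no $P'$ with $P\to^*P'$ has a race condition. **Formulas of $\mathsf{PiL}$.** Let $\mathcal V$ be a countable set of variables containing all names. Formulas: $A,B ::= \circ \mid \langle x!t\rangle \mid (x?t) \mid A⅋B \mid A\otimes B\mid A\blacktriangleleft B\mid \bigoplus_{i\in I} A_i\mid \&_{i\in I} A_i\mid \forall x.A\mid\exists x.A\mid \mathsf{New}\,x.A\mid\mathsf{Ya}\,x.A$ with $x\in\mathcal V$, $t$ a variable or a label (labels are constants: never quantified and never witnesses of the $\exists$ rule), $I$ finite nonempty. Formulas are modulo $\alpha$-equivalence; formulas and sequents are *clean*: each variable is bound by at most one universal quantifier or at most one pair of dual nominal quantifiers ($\mathsf{New}$/$\mathsf{Ya}$), and bound variables do not also occur free. **Translation.** $[\![\mathsf{Nil}]\!]=\circ$, $[\![P|Q]\!]=[\![P]\!]⅋[\![Q]\!]$, $[\![(\nu x)P]\!]=\mathsf{New}\,x.[\![P]\!]$, $[\![x!\langle y\rangle.P]\!]=\langle x!y\rangle\blacktriangleleft[\![P]\!]$, $[\![x?(y).P]\!]=\exists y.((x?y)\blacktriangleleft[\![P]\!])$, $[\![x\triangleleft\{\ell:P_\ell\}_{\ell\in L}]\!]=\&_{\ell\in L}(\langle x!\ell\rangle\blacktriangleleft[\![P_\ell]\!])$, $[\![x\triangleright\{\ell:P_\ell\}_{\ell\in L}]\!]=\bigoplus_{\ell\in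 L}((x?\ell)\blacktriangleleft[\![P_\ell]\!])$. **Rules of $\mathsf{PiL}$.** Judgements are $\mathcal S\vdash\Gamma$ with $\Gamma$ a finite set of formula occurrences and $\mathcal S$ a store: a set of elements $x^{\mathsf{New}}$ or $x^{\mathsf{Ya}}$, each variable at most once; $\mathcal S_1,\mathcal S_2$ is a union without common variables. Rules (premises $\Rightarrow$ conclusion; $\dagger$: $x$ not free in $\Gamma$): - ax: $\Rightarrow \mathcal S\vdash\langle x!t\rangle,(x?t)$. Unit: $\Rightarrow\mathcal S\vdash\circ$. - $⅋$: $\mathcal S\vdash\Gamma,A,B\Rightarrow\mathcal S\vdash\Gamma,A⅋B$. $\otimes$: $\mathcal S_1\vdash\Gamma,A$ and $\mathcal S_2\vdash B,\Delta\Rightarrow\mathcal S_1,\mathcal S_2\vdash\Gamma,A\otimes B,\Delta$. mix: $\mathcal S_1\vdash\Gamma$ and $\mathcal S_2\vdash\Delta\Rightarrow\mathcal S_1,\mathcal S_2\vdash\Gamma,\Delta$. - $\oplus$: $\mathcal S\vdash\Gamma,A_k\Rightarrow\mathcal S\vdash\Gamma,\bigoplus_{i\in I}A_i$ ($k\in I$). $\&$: $\mathcal S\vdash\Gamma,A_i$ for all $i\in I$ $\Rightarrow\mathcal S\vdash\Gamma,\&_{i\in I}A_i$. - $\forall$: $\mathcal S\vdash\Gamma,A\Rightarrow\mathcal S\vdash\Gamma,\forall x.A$ ($\dagger$). $\exists$: $\mathcal S\vdash\Gamma,A[y/x]\Rightarrow\mathcal S\vdash\Gamma,\exists x.A$,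 $y\in\mathcal V$. - $\blacktriangleleft$: $\mathcal S_1\vdash\Gamma,A,C$ and $\mathcal S_2\vdash\Delta,B,D\Rightarrow\mathcal S_1,\mathcal S_2\vdash\Gamma,\Delta,A\blacktriangleleft B,C\blacktriangleleft D$. $\blacktriangleleft^\circ$: $\mathcal S_1\vdash\Gamma,A$ and $\mathcal S_2\vdash\Delta,B\Rightarrow\mathcal S_1,\mathcal S_2\vdash\Gamma,\Delta,A\blacktriangleleft B$. - $\mathsf{New}_\circ$: $\mathcal S\vdash\Gamma,A\Rightarrow\mathcal S\vdash\Gamma,\mathsf{New}\,x.A$ ($\dagger$). $\mathsf{New}_{load}$: $\mathcal S,x^{\mathsf{New}}\vdash\Gamma,A\Rightarrow\mathcal S\vdash\Gamma,\mathsf{New}\,x.A$ ($\dagger$). $\mathsf{New}_{pop}$: $\mathcal S\vdash\Gamma,A[y/x]\Rightarrow\mathcal S,y^{\mathsf{New}}\vdash\Gamma,\mathsf{Ya}\,x.A$. - $\mathsf{Ya}_\circ,\mathsf{Ya}_{load},\mathsf{Ya}_{pop}$: the same three rules with $\mathsf{New}$ and $\mathsf{Ya}$ exchanged. $\vdash_{\mathsf{PiL}}\Gamma$ means $\emptyset\vdash\Gamma$ is derivable.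
   Formalization: The rule Choice is restricted to label sets L with at least two labels; for L={ℓ} it would be an identity step, making x◁{ℓ:Nil} race-free and never stuck although its translation is not derivable. *)

(* Defs.v *)
From Stdlib Require Import Permutation Relations.
From mathcomp Require Import all_boot.

Set Implicit Arguments.
Unset Strict Implicit.
Unset Printing Implicit Defensive.

(** * Processes

    Processes are taken modulo alpha-equivalence: binding is represented by
    de Bruijn indices.  Under [n] binders, index [i < n] is the variable of the
    [i]-th enclosing binder (innermost first) and index [n + j] is the free
    name [j].  Every alpha-class has exactly one representative, and every
    alpha-class contains an unambiguously written process. *)

Definition name := nat.

Inductive proc (Lab : finType) : Type :=
| PNil
| POut (x y : name) (P : proc Lab)
| PIn (x : name) (P : proc Lab)  (* x?(y).P; binds index 0 in P, not in x *)
| PPar (P Q : proc Lab)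
| PNu (P : proc Lab)
| PSel (x : name) (L : {set Lab}) (L_neq0 : L != set0)
      (P : forall l, l \in L -> proc Lab)
| PBra (x : name) (L : {set Lab}) (L_neq0 : L != set0)
      (P : forall l, l \in L -> proc Lab).

Arguments PNil {Lab}.

(* Names are only ever replaced by names, so capture-avoiding substitution,
   weakening and exchange of binders are all renamings. *)

Definition up (f : name -> name) (n : name) : name :=
  if n is m.+1 then (f m).+1 else 0.

Fixpoint ren (Lab : finType) (f : name -> name) (P : proc Lab) : proc Lab :=
  match P with
  | PNil => PNil
  | POut x y P => POut (f x) (f y) (ren f P)
  | PIn x P => PIn (f x) (ren (up f) P)
  | PPar P Q => PPar (ren f P) (ren f Q)
  | PNu P => PNu (ren (up f) P)
  | PSel x L L0 P => PSel (f x) L0 (fun l hl => ren f (P l hl))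
  | PBra x L L0 P => PBra (f x) L0 (fun l hl => ren f (P l hl))
  end.

(* P[a/b], where b is the variable (index 0) of a binder just removed. *)
Definition inst (Lab : finType) (a : name) (P : proc Lab) : proc Lab :=
  ren (fun n => if n is m.+1 then m else a) P.

(* P placed under one more binder, whose variable is not free in it. *)
Definition shift (Lab : finType) (P : proc Lab) : proc Lab := ren succn P.

Definition swap (Lab : finType) (P : proc Lab) : proc Lab :=
  ren (fun n => match n with 0 => 1 | 1 => 0 | _ => n end) P.

Inductive pctx (Lab : finType) : Type :=
| CHole
| COut (x y : name) (C : pctx Lab)
| CIn (x : name) (C : pctx Lab)
| CParL (C : pctx Lab) (Q : proc Lab)
| CParR (P : proc Lab) (C : pctx Lab)
| CNu (C : pctx Lab)
| CSel (x : name) (L : {set Lab}) (L_neq0 : L != set0)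
       (k : Lab) (k_in : k \in L) (C : pctx Lab)
       (P : forall l, l \in L -> proc Lab)
| CBra (x : name) (L : {set Lab}) (L_neq0 : L != set0)
       (k : Lab) (k_in : k \in L) (C : pctx Lab)
       (P : forall l, l \in L -> proc Lab).

(* The hole may be captured.  In [CSel] and [CBra] the hole lies in the branch
   [k]; the component of the family [P] at [k] is ignored. *)
Fixpoint plug (Lab : finType) (C : pctx Lab) (S : proc Lab) : proc Lab :=
  match C with
  | CHole => S
  | COut x y C => POut x y (plug C S)
  | CIn x C => PIn x (plug C S)
  | CParL C Q => PPar (plug C S) Q
  | CParR P C => PPar P (plug C S)
  | CNu C => PNu (plug C S)
  | CSel x L L0 k _ C P =>
      PSel x L0 (fun l hl => if l == k then plug C S else P l hl)
  | CBra x L L0 k _ C P =>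
      PBra x L0 (fun l hl => if l == k then plug C S else P l hl)
  end.

Inductive struct_ax (Lab : finType) : proc Lab -> proc Lab -> Prop :=
| struct_comm P Q : struct_ax (PPar P Q) (PPar Q P)
| struct_assocl P Q R : struct_ax (PPar (PPar P Q) R) (PPar P (PPar Q R))
| struct_assocr P Q R : struct_ax (PPar P (PPar Q R)) (PPar (PPar P Q) R)
| struct_nuC P : struct_ax (PNu (PNu P)) (PNu (PNu (swap P)))
| struct_nil P : struct_ax (PPar P PNil) P
| struct_nu0 S : struct_ax (PNu (shift S)) S
| struct_extr P S : struct_ax (PPar (PNu P) S) (PNu (PPar P (shift S))).

Definition struct_step (Lab : finType) (P Q : proc Lab) : Prop :=
  exists C S S', [/\ struct_ax S S', P = plug C S & Q = plug C S'].

Definition structs (Lab : finType) : relation (proc Lab) :=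
  clos_refl_trans _ (@struct_step Lab).

Definition struct_equiv (Lab : finType) : relation (proc Lab) :=
  clos_refl_sym_trans _ (@struct_step Lab).

(** * Reduction *)

Lemma set1_neq0 (T : finType) (k : T) : [set k] != set0.
Proof. by apply/set0Pn; exists k; rewrite set11. Qed.

(* [red b P Q]: P reduces to Q, and [b] tells whether the last rule is Struc.
   In Choice, L has at least two labels: for L = {k} the rule would be the
   identity step, so that x <| {k : Nil} would reduce forever to itself and
   hence not be stuck. *)
Inductive red (Lab : finType) : bool -> proc Lab -> proc Lab -> Prop :=
| red_com x a P Q :
    red false (PPar (POut x a P) (PIn x Q)) (PPar P (inst a Q))
| red_choice x (L : {set Lab}) (L0 : L != set0) P k (hk : k \in L) :
    1 < #|L| ->
    red false (PSel x L0 P) (PSel x (set1_neq0 k) (fun _ _ => P k hk))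
| red_label x k P (L : {set Lab}) (L0 : L != set0) Q (hk : k \in L) :
    red false (PPar (PSel x (set1_neq0 k) (fun _ _ => P)) (PBra x L0 Q))
              (PPar P (Q k hk))
| red_res b P P' : red b P P' -> red false (PNu P) (PNu P')
| red_par b P P' Q : red b P P' -> red false (PPar P Q) (PPar P' Q)
| red_struc b P C S S' :
    structs P (plug C S) -> P <> plug C S ->
    red false S S' -> red b (plug C S) (plug C S') ->
    red true P (plug C S').

Definition reduces (Lab : finType) (P Q : proc Lab) : Prop :=
  exists b, red b P Q.

Definition reduces_star (Lab : finType) : relation (proc Lab) :=
  clos_refl_trans _ (@reduces Lab).

Definition stuck (Lab : finType) (P : proc Lab) : Prop :=
  ~ struct_equiv P PNil /\ ~ exists P', reduces P P'.

Definition deadlock_free (Lab : finType) (P : proc Lab) : Prop :=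
  ~ exists P', reduces_star P P' /\ stuck P'.

(** * Races *)

(* (nu x_1)...(nu x_k)(S | P_1 | ... | P_n) *)
Definition net (Lab : finType) (k : nat) (Ps : seq (proc Lab)) (S : proc Lab) :
  proc Lab := iter k (@PNu Lab) (foldl (@PPar Lab) S Ps).

Inductive clash (Lab : finType) : proc Lab -> Prop :=
| clash_out x y z R Q : clash (PPar (POut x y R) (POut x z Q))
| clash_in x R Q : clash (PPar (PIn x R) (PIn x Q))
| clash_sel x (L L' : {set Lab}) (L0 : L != set0) (L0' : L' != set0) R Q :
    clash (PPar (PSel x L0 R) (PSel x L0' Q))
| clash_bra x (L L' : {set Lab}) (L0 : L != set0) (L0' : L' != set0) R Q :
    clash (PPar (PBra x L0 R) (PBra x L0' Q)).

Definition has_race (Lab : finType) (P : proc Lab) : Prop :=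
  exists k Ps S, clash S /\ struct_equiv P (net k Ps S).

Definition race_free (Lab : finType) (P : proc Lab) : Prop :=
  forall P', reduces_star P P' -> ~ has_race P'.

(** * Formulas

    The set of variables is the disjoint union of the names and of an arbitrary
    countable (possibly empty) type [E] of further variables.  Formulas are
    taken modulo alpha-equivalence, with bound variables in the left summand as
    de Bruijn indices; every alpha-class contains clean formulas. *)

Notation var E := (name + Countable.sort E)%type.

Inductive term (Lab : finType) (E : countType) : Type :=
| TVar (x : var E)
| TLab (l : Lab).

Arguments TVar {Lab E} x.
Arguments TLab {Lab E} l.

Inductive nominal := New | Ya.

Definition dual (q : nominal) : nominal :=
  match q with New => Ya | Ya => New end.

Inductive form (Lab : finType) (E : countType) : Type :=
| FUnit
| FOut (x : var E) (t : term Lab E)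
| FIn (x : var E) (t : term Lab E)
| FPar (A B : form Lab E)
| FTens (A B : form Lab E)
| FPrec (A B : form Lab E)
| FPlus (n : nat) (n_gt0 : 0 < n) (A : 'I_n -> form Lab E)
| FWith (n : nat) (n_gt0 : 0 < n) (A : 'I_n -> form Lab E)
| FAll (A : form Lab E)
| FEx (A : form Lab E)
| FNom (q : nominal) (A : form Lab E).

Arguments FUnit {Lab E}.

Definition vshift (E : countType) (x : var E) : var E :=
  match x with inl n => inl n.+1 | inr e => inr e end.

Definition vup (E : countType) (f : var E -> var E) (x : var E) : var E :=
  match x with
  | inl 0 => inl 0
  | inl m.+1 => vshift (f (inl m))
  | inr e => vshift (f (inr e))
  end.

Definition tren (Lab : finType) (E : countType) (f : var E -> var E)
  (t : term Lab E) : term Lab E :=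
  match t with TVar x => TVar (f x) | TLab l => TLab l end.

Fixpoint fren (Lab : finType) (E : countType) (f : var E -> var E)
  (A : form Lab E) : form Lab E :=
  match A with
  | FUnit => FUnit
  | FOut x t => FOut (f x) (tren f t)
  | FIn x t => FIn (f x) (tren f t)
  | FPar A B => FPar (fren f A) (fren f B)
  | FTens A B => FTens (fren f A) (fren f B)
  | FPrec A B => FPrec (fren f A) (fren f B)
  | FPlus n n0 A => FPlus n0 (fun i => fren f (A i))
  | FWith n n0 A => FWith n0 (fun i => fren f (A i))
  | FAll A => FAll (fren (vup f) A)
  | FEx A => FEx (fren (vup f) A)
  | FNom q A => FNom q (fren (vup f) A)
  end.

(* A[y/x], where x is the variable (index 0) of a binder just removed. *)
Definition finst (Lab : finType) (E : countType) (y : var E)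
  (A : form Lab E) : form Lab E :=
  fren (fun v => match v with
                 | inl 0 => y
                 | inl m.+1 => inl m
                 | inr e => inr e
                 end) A.

Fixpoint free (Lab : finType) (E : countType) (y : var E)
  (A : form Lab E) : Prop :=
  let freet t := if t is TVar z then y = z else False in
  match A with
  | FUnit => False
  | FOut x t | FIn x t => y = x \/ freet t
  | FPar A B | FTens A B | FPrec A B => free y A \/ free y B
  | FPlus _ _ A | FWith _ _ A => exists i, free y (A i)
  | FAll A | FEx A | FNom _ A => free (vshift y) A
  end.

Fixpoint fresh (Lab : finType) (E : countType) (y : var E)
  (G : seq (form Lab E)) : Prop :=
  if G is A :: G' then ~ free y A /\ fresh y G' else True.

Fixpoint tr (Lab : finType) (E : countType) (P : proc Lab) : form Lab E :=
  match P with
  | PNil => FUnit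
  | POut x y P => FPrec (FOut (inl x) (TVar (inl y))) (tr E P)
  | PIn x P => FEx (FPrec (FIn (inl x.+1) (TVar (inl 0))) (tr E P))
  | PPar P Q => FPar (tr E P) (tr E Q)
  | PNu P => FNom New (tr E P)
  | PSel x L L0 P =>
      FWith (etrans (card_gt0 L) L0) (fun i : 'I_#|L| =>
        FPrec (FOut (inl x) (TLab (enum_val i))) (tr E (P _ (enum_valP i))))
  | PBra x L L0 P =>
      FPlus (etrans (card_gt0 L) L0) (fun i : 'I_#|L| =>
        FPrec (FIn (inl x) (TLab (enum_val i))) (tr E (P _ (enum_valP i))))
  end.

(** * The proof system *)

(* A set of polarised variables containing each variable at most once. *)
Definition store (E : countType) : Type := var E -> option nominal.

Definition store0 (E : countType) : store E := fun _ => None.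

Definition store1 (E : countType) (x : var E) (q : nominal) : store E :=
  fun v => if v == x then Some q else None.

(* S is the union of S1 and S2, which have no common variable. *)
Definition store_join (E : countType) (S1 S2 S : store E) : Prop :=
  forall v, (S1 v = None /\ S v = S2 v) \/ (S2 v = None /\ S v = S1 v).

(* [RNomO q], [RNomLoad q] and [RNomPop q] are the three rules named after the
   quantifier [q]; the last one pops a [q]-variable on the quantifier dual to
   [q]. *)
Inductive rule :=
| RAx | RUnit | RPar | RTens | RMix | RPlus | RWith | RAll | REx
| RPrec | RPrecO | RNomO (q : nominal) | RNomLoad (q : nominal)
| RNomPop (q : nominal).

(* [pil R S G]: derivability of S |- G with the rules in R.  Sequents are
   multisets: lists up to exchange.  In the rules for universal and nominal
   quantifiers, y is the name given to the bound variable; it must not be free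
   in the quantified formula, as required of an alpha-renaming, nor in the
   context. *)
Inductive pil (Lab : finType) (E : countType) (R : rule -> bool) :
  store E -> seq (form Lab E) -> Prop :=
| pil_exch S G G' : Permutation G G' -> pil R S G -> pil R S G'
| pil_ax S x t : R RAx -> pil R S [:: FOut x t; FIn x t]
| pil_unit S : R RUnit -> pil R S [:: FUnit]
| pil_par S G A B : R RPar ->
    pil R S (A :: B :: G) -> pil R S (FPar A B :: G)
| pil_tens S S1 S2 G D A B : R RTens -> store_join S1 S2 S ->
    pil R S1 (A :: G) -> pil R S2 (B :: D) ->
    pil R S (FTens A B :: G ++ D)
| pil_mix S S1 S2 G D : R RMix -> store_join S1 S2 S ->
    pil R S1 G -> pil R S2 D -> pil R S (G ++ D)
| pil_plus S G n (n0 : 0 < n) A k : R RPlus ->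
    pil R S (A k :: G) -> pil R S (FPlus n0 A :: G)
| pil_with S G n (n0 : 0 < n) A : R RWith ->
    (forall i, pil R S (A i :: G)) -> pil R S (FWith n0 A :: G)
| pil_all S G A y : R RAll -> fresh y (FAll A :: G) ->
    pil R S (finst y A :: G) -> pil R S (FAll A :: G)
| pil_ex S G A y : R REx ->
    pil R S (finst y A :: G) -> pil R S (FEx A :: G)
| pil_prec S S1 S2 G D A B C F : R RPrec -> store_join S1 S2 S ->
    pil R S1 (A :: C :: G) -> pil R S2 (B :: F :: D) ->
    pil R S (FPrec A B :: FPrec C F :: G ++ D)
| pil_precO S S1 S2 G D A B : R RPrecO -> store_join S1 S2 S ->
    pil R S1 (A :: G) -> pil R S2 (B :: D) ->
    pil R S (FPrec A B :: G ++ D)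
| pil_nomO q S G A y : R (RNomO q) -> fresh y (FNom q A :: G) ->
    pil R S (finst y A :: G) -> pil R S (FNom q A :: G)
| pil_nomLoad q S S' G A y : R (RNomLoad q) -> fresh y (FNom q A :: G) ->
    store_join S (store1 y q) S' ->
    pil R S' (finst y A :: G) -> pil R S (FNom q A :: G)
| pil_nomPop q S S' G A y : R (RNomPop q) ->
    store_join S (store1 y q) S' ->
    pil R S (finst y A :: G) -> pil R S' (FNom (dual q) A :: G).

Definition provable_with (Lab : finType) (E : countType) (R : rule -> bool)
  (A : form Lab E) : Prop := pil R (@store0 E) [:: A].

Definition all_rules (r : rule) : bool := true.

Definition process_rules (r : rule) : bool :=
  match r with
  | RUnit | RAx | RPar | RMix | RPrec | RWith | RPlus | REx | RNomO New => true
  | _ => false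
  end.

Definition provable (Lab : finType) (E : countType) (A : form Lab E) : Prop :=
  provable_with all_rules A.

(* Main.v *)
Require Import Defs.
From Stdlib Require Import Permutation Relations List Classical.
From Stdlib Require Import FunctionalExtensionality Eqdep_dec.
From mathcomp Require Import all_boot zify.

Set Implicit Arguments.
Unset Strict Implicit.
Unset Printing Implicit Defensive.

(** Restrictions only provide fresh names, so a process can be run as a multiset
    of processes in which they have been opened.  Call such a multiset good if
    some schedule of communications empties it whatever the internal choices.
    A derivation is such a schedule: [&] ranges over the choices, and the prefix
    rule applied to two dual atoms is a communication.  When a prefix rule keeps
    further formulas next to its atoms, their continuations are released one by
    one while the derivation of the atoms is executed.

    Without races, two different redexes that overlap are two branches of one
    choice, so steps commute, goodness is preserved by every reduction, and a
    good process is deadlock-free.  Conversely, reductions shrink a process and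
    preserve deadlock-freedom, so any available step can open the schedule of a
    deadlock-free process. *)

(** * Renamings *)

(** Reduction rewrites along the one-way [structs], whereas being stuck refers to the symmetric
    [struct_equiv]. Passing to multisets bridges the two, because goodness is unaffected by
    restructuring in either direction. The inductive [good] serves twice: at [false] it captures the
    processes that are not stuck, at [true] those that have a schedule, and one proof of invariance
    under [struct_equiv] covers both.

    A derivation is not yet such a schedule. The rules for existentials and sums fix an object or a
    branch before the partner of the prefix is known, and the prefix rule sends an atom and its
    continuation to different premises. Hence a second notion, [igood], on prefixes that are already
    opened. It mimics derivations, and [igood_good] turns it back into [good]. Race-freedom enters
    through confluence, that is, in the passage from goodness to deadlock-freedom. *)

Lemma up_comp (f g : name -> name) : up f \o up g = up (f \o g).
Proof. by apply: functional_extensionality => -[|n]. Qed.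

Lemma up_id : up id = id.
Proof. by apply: functional_extensionality => -[|n]. Qed.

Lemma ren_comp (Lab : finType) (P : proc Lab) f g :
  ren f (ren g P) = ren (f \o g) P.
Proof.
elim: P f g => [|x y P IH|x P IH|P IHP Q IHQ|P IH|x L L0 P IH|x L L0 P IH] f g //=.
- by rewrite IH.
- by rewrite IH up_comp.
- by rewrite IHP IHQ.
- by rewrite IH up_comp.
- by congr PSel; do 2!apply: functional_extensionality_dep => ?; rewrite IH.
- by congr PBra; do 2!apply: functional_extensionality_dep => ?; rewrite IH.
Qed.

Lemma ren_id (Lab : finType) (P : proc Lab) : ren id P = P.
Proof.
elim: P => [|x y P IH|x P IH|P IHP Q IHQ|P IH|x L L0 P IH|x L L0 P IH] //=.
- by rewrite IH.
- by rewrite up_id IH.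
- by rewrite IHP IHQ.
- by rewrite up_id IH.
- by congr PSel; do 2!apply: functional_extensionality_dep => ?; rewrite IH.
- by congr PBra; do 2!apply: functional_extensionality_dep => ?; rewrite IH.
Qed.

Lemma ren_ext (Lab : finType) (P : proc Lab) f g : f =1 g -> ren f P = ren g P.
Proof. by move=> /functional_extensionality ->. Qed.

Lemma ren_idE (Lab : finType) (P : proc Lab) f : f =1 id -> ren f P = P.
Proof. by move=> /functional_extensionality ->; apply: ren_id. Qed.

Lemma ren_inst (Lab : finType) a (P : proc Lab) f :
  ren f (inst a P) = inst (f a) (ren (up f) P).
Proof. by rewrite /inst !ren_comp; apply: ren_ext => -[|n]. Qed.

Lemma ren_shift (Lab : finType) (P : proc Lab) f :
  ren (up f) (shift P) = shift (ren f P).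
Proof. by rewrite /shift !ren_comp. Qed.

Lemma ren_swap (Lab : finType) (P : proc Lab) f :
  ren (up (up f)) (swap P) = swap (ren (up (up f)) P).
Proof. by rewrite /swap !ren_comp; apply: ren_ext => -[|[|n]]. Qed.

Lemma swapK (Lab : finType) (P : proc Lab) : swap (swap P) = P.
Proof. by rewrite /swap ren_comp; apply: ren_idE => -[|[|n]]. Qed.

Lemma map_ren_comp (Lab : finType) (M : seq (proc Lab)) f g :
  map (ren f) (map (ren g) M) = map (ren (f \o g)) M.
Proof. by rewrite -map_comp; apply: eq_map => P /=; rewrite ren_comp. Qed.

Lemma map_ren_id (Lab : finType) (M : seq (proc Lab)) f :
  f =1 id -> map (ren f) M = M.
Proof. by move=> ff; elim: M => //= P M ->; rewrite ren_idE. Qed.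

Lemma map_ren_ext (Lab : finType) (M : seq (proc Lab)) f g :
  f =1 g -> map (ren f) M = map (ren g) M.
Proof. by move=> /functional_extensionality ->. Qed.

Definition upn (n : nat) (f : name -> name) : name -> name := iter n up f.

Lemma upnE n f i : upn n f i = if i < n then i else f (i - n) + n.
Proof.
elim: n i => [|n IH] i /=; first by rewrite subn0 addn0.
case: i => [|i] //=; rewrite -/(upn n f) IH ltnS subSS.
by case: ifP => // _; rewrite addnS.
Qed.

Lemma upn_add n f i : upn n f (n + i) = n + f i.
Proof. by rewrite upnE ltnNge leq_addr /= addKn addnC. Qed.

(** * Exchange *)

Lemma perm_cat2 T (A B C D : seq T) :
  Permutation A B -> Permutation C D -> Permutation (A ++ C) (B ++ D).
Proof. exact: Permutation_app. Qed.

Lemma perm_catC T (A B : seq T) : Permutation (A ++ B) (B ++ A).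
Proof. exact: Permutation_app_comm. Qed.

Lemma perm_catCA T (A B C : seq T) : Permutation (A ++ B ++ C) (B ++ A ++ C).
Proof. by rewrite !catA; apply: perm_cat2 => //; apply: perm_catC. Qed.

Lemma perm_mid T (x : T) A B : Permutation (x :: A ++ B) (A ++ x :: B).
Proof. exact: (perm_catCA [:: x]). Qed.

Lemma perm_map2 T U (f : T -> U) A B :
  Permutation A B -> Permutation (map f A) (map f B).
Proof. exact: Permutation_map. Qed.

Lemma in_perm_cons T (x : T) A : In x A -> exists A', Permutation A (x :: A').
Proof.
elim: A => [//|y A IH] /= [->|/IH [A' pA]]; first by exists A.
exists (y :: A'); apply: Permutation_trans (perm_skip _ pA) _.
exact: Permutation.perm_swap.
Qed.

Lemma perm_cat_cons T (A B R : seq T) x : Permutation (A ++ B) (x :: R) ->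
  (exists A', Permutation A (x :: A') /\ Permutation (A' ++ B) R) \/
  (exists B', Permutation B (x :: B') /\ Permutation (A ++ B') R).
Proof.
move=> p; have : In x (A ++ B).
  by apply: Permutation_in (Permutation_sym p) _; left.
move=> xAB; case: (in_app_or A B x xAB) => xI; have [C pC] := in_perm_cons xI;
  [left|right]; exists C; split=> //;
  apply: (@Permutation_cons_inv _ _ _ x); apply: Permutation_trans p.
- by apply: (perm_cat2 (Permutation_sym pC)).
- apply: Permutation_trans (perm_mid _ _ _) _.
  by apply: perm_cat2 => //; apply: Permutation_sym.
Qed.

(** Sharing is tested on values, not on occurrences. Each element of [C] is missing from [A], so it
    can be cancelled inside [B]. *)
Lemma perm_cat_disjoint T (A B C D : seq T) :
  Permutation (A ++ B) (C ++ D) -> (forall z, In z A -> ~ In z C) ->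
  exists R, Permutation B (C ++ R) /\ Permutation D (A ++ R).
Proof.
elim: C B => [|c C IH] B p dis; first by exists B; split=> //; apply: Permutation_sym.
case: (perm_cat_cons p) => [[A' [pA _]]|[B' [pB pD]]].
  case: (dis c); last by left.
  by apply: Permutation_in (Permutation_sym pA) _; left.
have [|R [pB' pD']] := IH B' pD.
  by move=> z zA zC; apply: (dis z zA); right.
exists R; split=> //; apply: Permutation_trans pB _; exact: perm_skip.
Qed.

(** * Configurations *)

Lemma PSel_inj (Lab : finType) x x' (L L' : {set Lab}) L0 L0' P P' :
  PSel x (L := L) L0 P = PSel x' (L := L') L0' P' ->
  [/\ x = x', L = L' & forall l hl hl', P l hl = P' l hl'].
Proof.
move=> E; injection E => E1 E2 ->; split=> // l.
subst L'; have -> := inj_pair2_eq_dec _ (@eq_comparable _) _ _ _ _ E1.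
by move=> hl hl'; rewrite (bool_irrelevance hl hl').
Qed.

Lemma PBra_inj (Lab : finType) x x' (L L' : {set Lab}) L0 L0' P P' :
  PBra x (L := L) L0 P = PBra x' (L := L') L0' P' ->
  [/\ x = x', L = L' & forall l hl hl', P l hl = P' l hl'].
Proof.
move=> E; injection E => E1 E2 ->; split=> // l.
subst L'; have -> := inj_pair2_eq_dec _ (@eq_comparable _) _ _ _ _ E1.
by move=> hl hl'; rewrite (bool_irrelevance hl hl').
Qed.

Definition PSel1 (Lab : finType) x (k : Lab) (P : proc Lab) :=
  PSel x (set1_neq0 k) (fun _ _ => P).

Lemma PSel1_inj (Lab : finType) x x' (k k' : Lab) (P P' : proc Lab) :
  PSel1 x k P = PSel1 x' k' P' -> [/\ x = x', k = k' & P = P'].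
Proof.
case/PSel_inj => -> /setP /(_ k); rewrite set11 => /esym/set1P kk' PP'.
by subst k'; split=> //; apply: (PP' k (set11 k) (set11 k)).
Qed.

(* [act t n Xs Y]: the processes [Xs], next to any others, can be replaced by
   any [Ys] in [Y], the others being weakened by the [n] names that get opened.
   [t] marks the steps that only restructure the configuration. *)
Inductive act (Lab : finType) :
  bool -> nat -> seq (proc Lab) -> (seq (proc Lab) -> Prop) -> Prop :=
| act_nil : act true 0 [:: PNil] (eq [::])
| act_par P Q : act true 0 [:: PPar P Q] (eq [:: P; Q])
| act_nu P : act true 1 [:: PNu P] (eq [:: P])
| act_com x a P Q : act false 0 [:: POut x a P; PIn x Q] (eq [:: P; inst a Q])
| act_choice x (L : {set Lab}) (L0 : L != set0) P : 1 < #|L| ->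
    act false 0 [:: PSel x L0 P]
      (fun Ys => exists k hk, [:: PSel1 x k (P k hk)] = Ys)
| act_label x k P (L : {set Lab}) (L0 : L != set0) Q (hk : k \in L) :
    act false 0 [:: PSel1 x k P; PBra x L0 Q] (eq [:: P; Q k hk]).

(** Both directions serve in [good_fwd]: the given outcome of one action is pushed forward, and the
    outcomes of the other, over which the schedule quantifies, are pulled back. *)
Lemma act_ren (Lab : finType) t n (Xs : seq (proc Lab)) Y g : act t n Xs Y ->
  exists2 Y', act t n (map (ren g) Xs) Y' &
    (forall Ys, Y Ys -> Y' (map (ren (upn n g)) Ys)) /\
    (forall Zs, Y' Zs -> exists2 Ys, Y Ys & Zs = map (ren (upn n g)) Ys).
Proof.
case=> [|P Q|P|x a P Q|x L L0 P cL|x k P L L0 Q hk] /=.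
- by eexists; first exact: act_nil; split=> _ <- //; eexists.
- by eexists; first exact: act_par; split=> _ <- //; eexists.
- by eexists; first exact: act_nu; split=> _ <- //; eexists.
- eexists; first exact: act_com.
  by split=> _ <-; first rewrite /= ren_inst //; eexists; rewrite //= ren_inst.
- eexists; first exact: act_choice.
  split=> Ys [k [hk <-]]; first by exists k, hk.
  by eexists; [exists k, hk|].
- by eexists; first exact: (@act_label _ _ _ _ _ _ _ hk); split=> _ <- //; eexists.
Qed.

(* With [b], a configuration is good if some scheduling empties it whatever
   the internal choices; without [b], if it is empty or has a redex after
   restructuring. *)
Inductive good (Lab : finType) (b : bool) : seq (proc Lab) -> Prop :=
| good_nil : good b [::]
| good_act t n Xs Y M N : act t n Xs Y -> Permutation N (Xs ++ M) ->
    (t || b -> forall Ys, Y Ys -> good b (Ys ++ map (ren (addn n)) M)) ->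
    good b N.

Lemma good_perm (Lab : finType) b (M N : seq (proc Lab)) :
  Permutation M N -> good b M -> good b N.
Proof.
move=> p g; case: g p => [/Permutation_nil ->|]; first exact: good_nil.
move=> t n Xs Y M' N' a pN IH p; apply: good_act a _ IH.
by apply: Permutation_trans pN; apply: Permutation_sym.
Qed.

(* No injectivity is needed: identifying names only adds redexes. *)
Lemma good_ren (Lab : finType) b (N : seq (proc Lab)) :
  good b N -> forall g, good b (map (ren g) N).
Proof.
elim=> {N} [|t n Xs Y M N a p _ IH] g; first exact: good_nil.
have [Y' a' [_ Y'Y]] := act_ren g a.
apply: (good_act (M := map (ren g) M) a'); first by rewrite -map_cat; apply: perm_map2.
move=> tb Zs /Y'Y [Ys yY ->]; have := IH tb Ys yY (upn n g).
rewrite map_cat !map_ren_comp; congr (good _ (_ ++ _)).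
by apply: map_ren_ext => i /=; rewrite upn_add.
Qed.

Lemma good_admin (Lab : finType) b n X (Ys M : seq (proc Lab)) :
  act true n [:: X] (eq Ys) -> good b (Ys ++ map (ren (addn n)) M) ->
  good b (X :: M).
Proof. by move=> a g; apply: (good_act (M := M) a) => // _ _ <-. Qed.

Lemma act_fun (Lab : finType) t t' n n' (Xs Xs' : seq (proc Lab)) Y Y' :
  act t n Xs Y -> act t' n' Xs' Y' -> Xs = Xs' ->
  [/\ t = t', n = n' & forall Ys, Y Ys -> Y' Ys].
Proof.
case=> [|P Q|P|x a P Q|x L L0 P cL|x k P L L0 Q hk];
  case=> [|P' Q'|P'|x' a' P' Q'|x' L' L0' P' cL'|x' k' P' L' L0' Q' hk'] //.
- by case=> -> ->.
- by case=> ->.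
- by case=> _ -> -> _ ->.
- move=> /(congr1 (head PNil)) /= /[dup] E /PSel_inj [xx' LL' PP'].
  subst L'; split=> // Ys [k [hk <-]]; exists k, hk.
  by rewrite xx' (PP' k hk hk).
- move=> E; have /PSel1_inj [_ kk' ->] : PSel1 x k P = PSel1 x' k' P'.
    exact: (congr1 (head PNil) E).
  have /PBra_inj [_ LL' QQ'] : PBra x L0 Q = PBra x' L0' Q'.
    exact: (congr1 (head PNil \o behead) E).
  by subst k' L'; split=> // _ <-; rewrite (QQ' k hk hk').
Qed.

Definition rival (Lab : finType) (P Q : proc Lab) := clash (PPar P Q).

(** The head of a process fixes which kind of redex it belongs to and its side in it. Two redexes
    through [z] can thus differ only in the partner, and two partners of the same prefix have the
    same subject and polarity. Choice and Label share no selection, since Choice asks for two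
    labels. *)
Lemma act_share (Lab : finType) t t' n n' (Xs Xs' : seq (proc Lab)) Y Y' z :
  act t n Xs Y -> act t' n' Xs' Y' -> In z Xs -> In z Xs' ->
  Xs = Xs' \/
  exists a b b', rival b b' /\
   ((Xs = [:: a; b] /\ Xs' = [:: a; b']) \/ (Xs = [:: b; a] /\ Xs' = [:: b'; a])).
Proof.
case=> [|P Q|P|x a P Q|x L L0 P cL|x k P L L0 Q hk];
  case=> [|P' Q'|P'|x' a' P' Q'|x' L' L0' P' cL'|x' k' P' L' L0' Q' hk'] /=;
  try by intuition (subst; discriminate).
- by move=> [<-|//] [->|//]; left.
- by move=> [<-|//] [->|//]; left.
- move=> [<-|[<-|//]] [|[|//]] //; [case=> -> -> ->|case=> -> ->]; right.
    exists (POut x a P), (PIn x Q), (PIn x Q').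
    by split; [exact: clash_in|left].
  exists (PIn x Q), (POut x a P), (POut x a' P').
  by split; [exact: clash_out|right].
- by move=> [<-|//] [->|//]; left.
- by move=> [<-|//] [|[]] // /PSel_inj [_ E _]; rewrite -E cards1 in cL.
- by move=> [<-|[<-|//]] [] // /PSel_inj [_ E _]; rewrite E cards1 in cL'.
- move=> [<-|[<-|//]] [|[|//]] //; [case/PSel1_inj=> -> -> ->|move=> E]; right.
    exists (PSel1 x k P), (PBra x L0 Q), (PBra x L0' Q').
    by split; [exact: clash_bra|left].
  have [xx' _ _] := PBra_inj E; rewrite -E.
  exists (PBra x' L0' Q'), (PSel1 x k P), (PSel1 x' k' P').
  by split; [rewrite xx'; exact: clash_sel|right].
Qed.

Definition clash_free (Lab : finType) (N : seq (proc Lab)) :=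
  forall P Q M, rival P Q -> ~ Permutation N (P :: Q :: M).

(** A restructuring redex is a single process and has no partner to compete for. Otherwise two
    distinct partners of one process would both lie in the configuration, which is a clash. Equal
    partners fall under the first alternative even when they are different occurrences. *)
Lemma act_overlap (Lab : finType) t t' n n' (Xs Xs' M M' : seq (proc Lab)) Y Y' :
  act t n Xs Y -> act t' n' Xs' Y' -> Permutation (Xs ++ M) (Xs' ++ M') ->
  (t \/ clash_free (Xs ++ M)) ->
  (Xs = Xs' /\ Permutation M M') \/
  exists R, Permutation M (Xs' ++ R) /\ Permutation M' (Xs ++ R).
Proof.
move=> a a' p cf.
have [[z [zX zX']]|nsh] := classic (exists z, In z Xs /\ In z Xs'); last first.
  right; apply: perm_cat_disjoint => // z zX zX'.
  by apply: nsh; exists z.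
have [E|[c [d [d' [rv E]]]]] := act_share a a' zX zX'.
  by left; split=> //; subst Xs'; apply: Permutation_app_inv_l p.
have {}cf : clash_free (Xs ++ M).
  case: cf => // tt; case: E => -[E _]; move: a; rewrite E tt => a0;
  by inversion a0.
have {}p : Permutation (d :: M) (d' :: M').
  apply: (@Permutation_cons_inv _ _ _ c); case: E => -[E E'].
    by rewrite E E' in p.
  apply: Permutation_trans (Permutation.perm_swap _ _ _) _.
  apply: Permutation_trans (Permutation.perm_swap _ _ _); by rewrite E E' in p.
have [[A' [pA pD]]|[A' [pA pD]]] := @perm_cat_cons _ [:: d] M M' d' p.
  have {pA} [dd A0] : d = d' /\ A' = [::].
    by have [-> ->] := Permutation_length_1_inv pA.
  by subst; left; split=> //; case: E => -[-> ->].
case: (cf d d' (c :: A') rv).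
apply: (@Permutation_trans _ _ (c :: d :: M)).
  by case: E => -[-> _] /=; [exact: Permutation_refl|exact: Permutation.perm_swap].
apply: Permutation_trans (perm_mid c [:: d; d'] A').
exact/perm_skip/perm_skip.
Qed.

(** * Configurations as processes *)

Definition nus (Lab : finType) n (P : proc Lab) := iter n (@PNu Lab) P.

(** The singleton case makes [pars [:: P]] equal to [P]: [struct_nil] only removes [PNil], so a
    final unit could not be introduced by [structs]. *)
Fixpoint pars (Lab : finType) (M : seq (proc Lab)) : proc Lab :=
  match M with
  | [::] => PNil
  | [:: P] => P
  | P :: M' => PPar P (pars M')
  end.

Lemma structs_ax (Lab : finType) (P Q : proc Lab) : struct_ax P Q -> structs P Q.
Proof. by move=> a; apply: rt_step; exists (CHole Lab), P, Q. Qed.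

Lemma structs_refl (Lab : finType) (P : proc Lab) : structs P P.
Proof. exact: rt_refl. Qed.

Lemma structs_trans (Lab : finType) (P Q R : proc Lab) :
  structs P Q -> structs Q R -> structs P R.
Proof. exact: rt_trans. Qed.

Lemma structs_map (Lab : finType) (f : proc Lab -> proc Lab)
    (C : pctx Lab -> pctx Lab) P Q :
  (forall D S, f (plug D S) = plug (C D) S) -> structs P Q -> structs (f P) (f Q).
Proof.
move=> fC; elim=> {P Q} [_ _ [D [S [S' [a -> ->]]]]|P|P Q R _ IH1 _ IH2].
- by apply: rt_step; exists (C D), S, S'.
- exact: rt_refl.
- exact: rt_trans IH1 IH2.
Qed.

Lemma structs_parL (Lab : finType) (P Q R : proc Lab) :
  structs P Q -> structs (PPar P R) (PPar Q R).
Proof. exact: (@structs_map _ (fun X => PPar X R) (fun D => CParL D R)). Qed.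

Lemma structs_parR (Lab : finType) (P Q R : proc Lab) :
  structs P Q -> structs (PPar R P) (PPar R Q).
Proof. exact: (@structs_map _ (PPar R) (CParR R)). Qed.

Lemma structs_nus (Lab : finType) n (P Q : proc Lab) :
  structs P Q -> structs (nus n P) (nus n Q).
Proof. by elim: n => //= n IH /IH; apply: (@structs_map _ _ (@CNu Lab)). Qed.

Lemma pars_cons (Lab : finType) P Q (M : seq (proc Lab)) :
  pars [:: P, Q & M] = PPar P (pars (Q :: M)).
Proof. by []. Qed.

Lemma pars_perm (Lab : finType) (M N : seq (proc Lab)) :
  Permutation M N -> structs (pars M) (pars N).
Proof.
elim=> {M N} [|P M N p IH|P Q M|M N R _ IH1 _ IH2].
- exact: structs_refl.
- case: M N p IH => [|A M] [|B N] p IH.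
  + exact: structs_refl.
  + by have := Permutation_length p.
  + by have := Permutation_length p.
  + exact: structs_parR.
- case: M => [|R M]; first exact/structs_ax/struct_comm.
  rewrite !pars_cons; apply: structs_trans (structs_ax (struct_assocl _ _ _)).
  apply: structs_trans (structs_ax (struct_assocr _ _ _)) _.
  exact/structs_parL/structs_ax/struct_comm.
- exact: structs_trans IH1 IH2.
Qed.

Lemma pars_cat (Lab : finType) P Q (A B : seq (proc Lab)) :
  structs (pars ((P :: A) ++ Q :: B)) (PPar (pars (P :: A)) (pars (Q :: B))) /\
  structs (PPar (pars (P :: A)) (pars (Q :: B))) (pars ((P :: A) ++ Q :: B)).
Proof.
elim: A P => [|R A IH] P; first by split; apply: structs_refl.
rewrite !cat_cons !pars_cons; split.
  apply: structs_trans (structs_ax (struct_assocr _ _ _)).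
  exact: structs_parR (IH R).1.
apply: structs_trans (structs_ax (struct_assocl _ _ _)) _.
exact: structs_parR (IH R).2.
Qed.

Lemma pars_map_shift (Lab : finType) (M : seq (proc Lab)) :
  pars (map (@shift Lab) M) = shift (pars M).
Proof.
elim: M => [//|P [//|Q M] IH].
by rewrite pars_cons [RHS]/shift [RHS]/= -/(shift _) -/(shift _) -IH.
Qed.

Lemma act_structs (Lab : finType) n (Xs : seq (proc Lab)) Y Ys M :
  act true n Xs Y -> Y Ys ->
  structs (pars (Xs ++ M)) (nus n (pars (Ys ++ map (ren (addn n)) M))).
Proof.
move: (erefl true); move: {1 3}true => t tt a; case: a tt => //.
- move=> _ <-; rewrite map_ren_id //=.
  case: M => [|P M]; first exact: structs_refl.
  apply: structs_trans (structs_ax (struct_comm _ _)) _.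
  exact/structs_ax/struct_nil.
- move=> P Q _ <-; rewrite map_ren_id //=.
  case: M => [|R M]; first exact: structs_refl.
  exact/structs_ax/struct_assocl.
- move=> P _ <-; case: M => [|R M]; first exact: structs_refl.
  have -> : pars ([:: P] ++ map (ren (addn 1)) (R :: M)) =
    PPar P (pars (map (@shift Lab) (R :: M))) by [].
  rewrite pars_map_shift; exact/structs_ax/struct_extr.
Qed.

Lemma act_red (Lab : finType) n (Xs : seq (proc Lab)) Y Ys M :
  act false n Xs Y -> Y Ys ->
  n = 0 /\ exists Z Z', [/\ structs (pars (Xs ++ M)) Z, red false Z Z' &
    structs Z' (pars (Ys ++ M))].
Proof.
move=> a y; have {a y} [-> [P [A [Q [B [-> -> r]]]]]] : n = 0 /\ exists P A Q B,
    [/\ Xs = P :: A, Ys = Q :: B & red false (pars (P :: A)) (pars (Q :: B))].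
  move: (erefl false); move: {1 3}false a y => t a + tt; case: a tt => //.
  - by move=> x a P Q _ <-; split=> //; do 4!eexists; split=> //; apply: red_com.
  - move=> x L L0 P cL _ [k [hk <-]]; split=> //; do 4!eexists; split=> //.
    exact: red_choice.
  - move=> x k P L L0 Q hk _ <-; split=> //; do 4!eexists; split=> //.
    exact: red_label.
split=> //; case: M => [|R M].
  exists (pars (P :: A)), (pars (Q :: B)).
  by rewrite !cats0; split=> //; exact: structs_refl.
exists (PPar (pars (P :: A)) (pars (R :: M))), (PPar (pars (Q :: B)) (pars (R :: M))).
by split; [exact: (pars_cat _ _ _ _).1|exact: red_par r|exact: (pars_cat _ _ _ _).2].
Qed.

(** Struc demands a nontrivial rewriting, hence the case split: if [P] is already [Z], the given
    reduction is used as it is. *)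
Lemma reduces_intro (Lab : finType) (P Z Z' : proc Lab) :
  structs P Z -> red false Z Z' -> reduces P Z'.
Proof.
move=> PZ r; have [->|ne] := classic (P = Z); first by exists false.
by exists true; apply: (@red_struc _ false _ (CHole Lab) Z Z').
Qed.

Lemma red_nus (Lab : finType) n (P Q : proc Lab) :
  red false P Q -> red false (nus n P) (nus n Q).
Proof. by elim: n => //= n IH /IH; apply: red_res. Qed.

Lemma structs_equiv (Lab : finType) (P Q : proc Lab) :
  structs P Q -> struct_equiv P Q.
Proof. exact: clos_rt_clos_rst. Qed.

Lemma equiv_sym (Lab : finType) (P Q : proc Lab) :
  struct_equiv P Q -> struct_equiv Q P.
Proof. exact: rst_sym. Qed.

Lemma equiv_trans (Lab : finType) (P Q R : proc Lab) :
  struct_equiv P Q -> struct_equiv Q R -> struct_equiv P R.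
Proof. exact: rst_trans. Qed.

Lemma equiv_nu (Lab : finType) (P Q : proc Lab) :
  struct_equiv P Q -> struct_equiv (PNu P) (PNu Q).
Proof.
elim=> {P Q} [_ _ [D [S [S' [a -> ->]]]]|P|P Q _ IH|P Q R _ IH1 _ IH2].
- by apply: rst_step; exists (CNu D), S, S'.
- exact: rst_refl.
- exact: rst_sym.
- exact: rst_trans IH1 IH2.
Qed.

Lemma reduces_struct (Lab : finType) (P Q R : proc Lab) :
  structs P Q -> reduces Q R -> reduces P R.
Proof.
move=> PQ [[] r]; last exact: reduces_intro r.
inversion r as [| | | | |b Q' C S S' st ne r1 r2]; subst.
have [E|ne'] := classic (P = plug C S); first by exists b; rewrite E.
exists true; apply: red_struc ne' r1 r2; exact: structs_trans st.
Qed.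

(** * Races *)

(** The rewriting is absorbed by the first reduction from [Q], through Struc, or, if there is none,
    by the equivalence inside [has_race]. *)
Lemma race_free_structs (Lab : finType) (P Q : proc Lab) :
  structs P Q -> race_free P -> race_free Q.
Proof.
move=> PQ rf P' /clos_rt_rt1n_iff r [k [Ps [S [cl E]]]].
case: r E => [|Y Z QY YZ] E.
  apply: (rf P); first exact: rt_refl.
  by exists k, Ps, S; split=> //; apply: equiv_trans E; apply: structs_equiv.
apply: (rf Z); last by exists k, Ps, S.
apply: (@rt_trans _ _ _ Y); first by apply: rt_step; apply: reduces_struct QY.
exact/clos_rt_rt1n_iff.
Qed.

Lemma race_free_reduces (Lab : finType) (P Q : proc Lab) :
  reduces_star P Q -> race_free P -> race_free Q.
Proof. by move=> PQ rf P' QP'; apply: rf; apply: rt_trans QP'. Qed.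

Lemma reduces_nu (Lab : finType) (P Q : proc Lab) :
  reduces P Q -> reduces (PNu P) (PNu Q).
Proof. by case=> b r; exists false; apply: red_res r. Qed.

Lemma race_free_nu (Lab : finType) (P : proc Lab) :
  race_free (PNu P) -> race_free P.
Proof.
move=> rf P' r [k [Ps [S [cl E]]]]; apply: (rf (PNu P')).
  elim: r => [X Y XY|X|X Y Z _ IH1 _ IH2].
  - exact/rt_step/reduces_nu.
  - exact: rt_refl.
  - exact: rt_trans IH1 IH2.
by exists k.+1, Ps, S; split=> //; apply: equiv_nu.
Qed.

Lemma race_free_act (Lab : finType) t n (Xs : seq (proc Lab)) Y Ys M :
  act t n Xs Y -> Y Ys -> race_free (pars (Xs ++ M)) ->
  race_free (pars (Ys ++ map (ren (addn n)) M)).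
Proof.
case: t => a y.
  move/(race_free_structs (act_structs M a y)).
  by elim: n {a} (pars _) => //= n IH P /race_free_nu /IH.
have [n0 [Z [Z' [s1 r s2]]]] := act_red M a y.
subst n; rewrite map_ren_id // => /(race_free_structs s1).
move=> /race_free_reduces rf; apply: race_free_structs s2 _; apply: rf.
by apply: rt_step; exists false.
Qed.

Lemma race_free_clash (Lab : finType) (N : seq (proc Lab)) :
  race_free (pars N) -> clash_free N.
Proof.
move=> rf P Q M cl p; apply: (rf (pars N)); first exact: rt_refl.
exists 0, [:: pars M], (PPar P Q); split=> //=.
apply: equiv_trans (structs_equiv (pars_perm p)) _.
case: M {p} => [|R M].
  by apply/equiv_sym/structs_equiv/structs_ax/struct_nil.
rewrite !pars_cons; exact/structs_equiv/structs_ax/struct_assocr.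
Qed.

(** * Confluence *)

Lemma perm_ren_ext (Lab : finType) (M : seq (proc Lab)) f g :
  f =1 g -> Permutation (map (ren f) M) (map (ren g) M).
Proof. by move=> /functional_extensionality ->; apply: Permutation_refl. Qed.

(* The restructuring case [t] is inversion, the other one confluence. *)
Lemma good_fwd (Lab : finType) b t n (N Xs : seq (proc Lab)) Y Ys M :
  good b N -> act t n Xs Y -> Y Ys -> Permutation N (Xs ++ M) ->
  t \/ b /\ race_free (pars N) -> good b (Ys ++ map (ren (addn n)) M).
Proof.
move=> g; elim: g t n Xs Y Ys M => {N} [|t' n' Xs' Y' M' N a' pN' g IH]
  t n Xs Y Ys M a y pN tb.
  by have := Permutation_nil pN; case: a pN {tb}.
have p := Permutation_trans (Permutation_sym pN) pN'.
have cf : t \/ clash_free (Xs ++ M).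
  case: tb => [->|[_ /race_free_clash cf]]; [by left|right=> P Q R cl p'].
  by apply: (cf P Q R cl); apply: Permutation_trans p'.
(* Either the redex is the one scheduled first, and the schedule covers all its outcomes, or the two
   redexes are disjoint and the scheduled one is still available after the other. *)
have [[E pM]|[R [pM pM']]] := act_overlap a a' p cf.
  have [tt' nn' YY'] := act_fun a a' E; subst t' n'.
  apply: good_perm (g _ _ (YY' _ y)); last by case: tb => [->|[->]] //; rewrite orbT.
  exact/perm_cat2/perm_map2/Permutation_sym.
have [Y1' a1' [_ Y1'Y']] := act_ren (addn n) a'.
have [Y1 a1 [YY1 _]] := act_ren (addn n') a.
apply: (good_act (M := Ys ++ map (ren (addn n)) R) a1').
  apply: Permutation_trans (perm_catCA _ _ _); rewrite -map_cat.
  exact/perm_cat2/perm_map2.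
move=> tb' Zs /Y1'Y' [Ys' y' ->].
have pM1 : Permutation (Ys' ++ map (ren (addn n')) M')
    (map (ren (addn n')) Xs ++ Ys' ++ map (ren (addn n')) R).
  apply: Permutation_trans (perm_catCA _ _ _); rewrite -map_cat.
  exact/perm_cat2/perm_map2.
have {}IH := IH tb' Ys' y' _ _ _ _ _ _ a1 (YY1 _ y) pM1.
(* The induction hypothesis opens the [n'] names first and then the [n] names, the goal the other
   way round; [s] exchanges the two blocks. *)
pose s i := if i < n then i + n' else if i < n + n' then i - n else i.
have := good_ren (IH _) s; rewrite !map_cat !map_ren_comp => {}IH.
apply: good_perm (IH _); last first.
  case: tb => [->|[-> rf]]; [by left|right; split=> //].
  exact/(race_free_act a' y')/(race_free_structs (pars_perm pN')).
apply: Permutation_trans (perm_catCA _ _ _) _; apply: perm_cat2; last apply: perm_cat2.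
- apply: perm_ren_ext => i /=.
  rewrite /s upnE; repeat (case: ltnP => ? /=); lia.
- apply: perm_ren_ext => i /=.
  rewrite /s upnE; case: (ltnP i n) => ?; repeat (case: ltnP => ? /=); lia.
- apply: perm_ren_ext => i /=.
  rewrite /s; repeat (case: ltnP => ? /=); lia.
Qed.

Lemma good_nilE (Lab : finType) b (M : seq (proc Lab)) :
  good b (PNil :: M) <-> good b M.
Proof.
split=> g; last by apply: good_admin (act_nil _) _; rewrite map_ren_id.
have := good_fwd g (act_nil _) erefl (Permutation_refl _) (or_introl isT).
by rewrite map_ren_id.
Qed.

Lemma good_parE (Lab : finType) b (P Q : proc Lab) M :
  good b (PPar P Q :: M) <-> good b [:: P, Q & M].
Proof.
split=> g; last by apply: good_admin (act_par P Q) _; rewrite map_ren_id.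
have := good_fwd g (act_par P Q) erefl (Permutation_refl _) (or_introl isT).
by rewrite map_ren_id.
Qed.

Lemma good_nuE (Lab : finType) b (P : proc Lab) M :
  good b (PNu P :: M) <-> good b (P :: map (@shift Lab) M).
Proof.
split=> g; last exact: good_admin (act_nu P) _.
exact: (good_fwd g (act_nu P) erefl (Permutation_refl _) (or_introl isT)).
Qed.

(** * Invariance under structural congruence *)

Lemma good_struct_ax (Lab : finType) b (P Q : proc Lab) M :
  struct_ax P Q -> good b (P :: M) <-> good b (Q :: M).
Proof.
case=> {P Q} [P Q|P Q R|P Q R|P|P|S|P S].
- by rewrite !good_parE; split; apply/good_perm/Permutation.perm_swap.
- rewrite !good_parE; split=> g.
    apply: good_perm (perm_mid (PPar Q R) [:: P] M) _; apply/good_parE.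
    by apply: good_perm g; exact: (perm_mid P [:: Q; R] M).
  have /good_parE := good_perm (Permutation_sym (perm_mid (PPar Q R) [:: P] M)) g.
  by apply: good_perm; apply/Permutation_sym; exact: (perm_mid P [:: Q; R] M).
- rewrite !good_parE; split=> g; last first.
    apply: good_perm (perm_mid (PPar Q R) [:: P] M) _; apply/good_parE.
    by apply: good_perm g; exact: (perm_mid P [:: Q; R] M).
  have /good_parE := good_perm (Permutation_sym (perm_mid (PPar Q R) [:: P] M)) g.
  by apply: good_perm; apply/Permutation_sym; exact: (perm_mid P [:: Q; R] M).
- have sw P' : good b (P' :: map (@shift _) (map (@shift _) M)) ->
      good b (swap P' :: map (@shift _) (map (@shift _) M)).
    move=> g; have := good_ren g (fun n => match n with 0 => 1 | 1 => 0 | _ => n end).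
    by rewrite /= !map_ren_comp.
  by rewrite !good_nuE; split=> /sw; rewrite ?swapK.
- rewrite good_parE; split=> g.
    by apply/good_nilE; apply: good_perm g; apply: Permutation.perm_swap.
  by move/good_nilE: g; apply: good_perm; apply: Permutation.perm_swap.
- rewrite good_nuE; split=> g; last exact: (good_ren g succn).
  (* Renaming by [predn] undoes the shift; its lack of injectivity is harmless to [good_ren]. *)
  by have := good_ren g predn; rewrite /= ren_comp ren_idE // map_ren_comp map_ren_id.
- rewrite good_parE !good_nuE good_parE /=; split; apply: good_perm;
  exact: Permutation_refl.
Qed.

(** A single step in either direction, with hole contexts replaced by congruence rules, so that it
    can be inverted on the head constructor. All branches of a family may change at once, which
    avoids singling out the branch that holds the hole. *)
Inductive sc (Lab : finType) : proc Lab -> proc Lab -> Prop :=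
| sc_refl P : sc P P
| sc_ax P Q : struct_ax P Q -> sc P Q
| sc_xa P Q : struct_ax Q P -> sc P Q
| sc_out x y P Q : sc P Q -> sc (POut x y P) (POut x y Q)
| sc_in x P Q : sc P Q -> sc (PIn x P) (PIn x Q)
| sc_parL P Q R : sc P Q -> sc (PPar P R) (PPar Q R)
| sc_parR P Q R : sc P Q -> sc (PPar R P) (PPar R Q)
| sc_nu P Q : sc P Q -> sc (PNu P) (PNu Q)
| sc_sel x (L : {set Lab}) (L0 : L != set0) P Q :
    (forall l hl, sc (P l hl) (Q l hl)) -> sc (PSel x L0 P) (PSel x L0 Q)
| sc_bra x (L : {set Lab}) (L0 : L != set0) P Q :
    (forall l hl, sc (P l hl) (Q l hl)) -> sc (PBra x L0 P) (PBra x L0 Q).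

Lemma struct_ax_ren (Lab : finType) (P Q : proc Lab) f :
  struct_ax P Q -> struct_ax (ren f P) (ren f Q).
Proof.
case=> {P Q} *; rewrite /= ?ren_shift ?ren_swap; by constructor.
Qed.

Lemma sc_ren (Lab : finType) (P Q : proc Lab) f : sc P Q -> sc (ren f P) (ren f Q).
Proof.
move=> s; elim: s f => {P Q} [P|P Q a|P Q a|x y P Q _ IH|x P Q _ IH|P Q R _ IH|
  P Q R _ IH|P Q _ IH|x L L0 P Q _ IH|x L L0 P Q _ IH] f /=;
  do ?[exact: sc_refl]; do ?[exact/sc_ax/struct_ax_ren];
  do ?[exact/sc_xa/struct_ax_ren].
- exact/sc_out/IH.
- exact/sc_in/IH.
- exact/sc_parL/IH.
- exact/sc_parR/IH.
- exact/sc_nu/IH.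
- by apply: sc_sel => l hl; apply: IH.
- by apply: sc_bra => l hl; apply: IH.
Qed.

Lemma struct_step_sc (Lab : finType) (P Q : proc Lab) :
  struct_step P Q -> sc P Q /\ sc Q P.
Proof.
case=> C [S [S' [a -> ->]]]; elim: C => /= [|x y C [IH IH']|x C [IH IH']|
  C [IH IH'] Q'|P' C [IH IH']|C [IH IH']|x L L0 k hk C [IH IH'] P'|
  x L L0 k hk C [IH IH'] P'];
  do ?[by split; [exact: sc_ax|exact: sc_xa]].
- by split; apply: sc_out.
- by split; apply: sc_in.
- by split; apply: sc_parL.
- by split; apply: sc_parR.
- by split; apply: sc_nu.
- by split; apply: sc_sel => l hl; case: eqP => _ //; apply: sc_refl.
- by split; apply: sc_bra => l hl; case: eqP => _ //; apply: sc_refl.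
Qed.

Lemma PSel_set1 (Lab : finType) x (k : Lab) L0
    (P : forall l, l \in [set k] -> proc Lab) :
  PSel x L0 P = PSel1 x k (P k (set11 k)).
Proof.
rewrite /PSel1 (bool_irrelevance L0 (set1_neq0 k)); congr PSel.
apply: functional_extensionality_dep => l; apply: functional_extensionality_dep => hl.
have E := set1P hl; subst l; congr P; exact: bool_irrelevance.
Qed.

Lemma sc_inv (Lab : finType) (P Q : proc Lab) : sc P Q ->
  [\/ P = Q, struct_ax P Q, struct_ax Q P |
   match P with
   | PNil => False
   | POut x y P1 => exists2 Q1, Q = POut x y Q1 & sc P1 Q1
   | PIn x P1 => exists2 Q1, Q = PIn x Q1 & sc P1 Q1
   | PPar P1 P2 => (exists2 Q1, Q = PPar Q1 P2 & sc P1 Q1) \/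
                   (exists2 Q2, Q = PPar P1 Q2 & sc P2 Q2)
   | PNu P1 => exists2 Q1, Q = PNu Q1 & sc P1 Q1
   | PSel x L L0 B => exists2 B', Q = PSel x L0 B' & forall l hl, sc (B l hl) (B' l hl)
   | PBra x L L0 B => exists2 B', Q = PBra x L0 B' & forall l hl, sc (B l hl) (B' l hl)
   end].
Proof.
case=> {P Q} [P|P Q a|P Q a|x y P Q s|x P Q s|P Q R s|P Q R s|P Q s|x L L0 P Q s|
  x L L0 P Q s]; first [by constructor 1|by constructor 2|by constructor 3|constructor 4].
- by exists Q.
- by exists Q.
- by left; exists Q.
- by right; exists Q.
- by exists Q.
- by exists Q.
- by exists Q.
Qed.

(** The schedule is followed until it touches [P]. An axiom at the root is then handled by
    [good_struct_ax]; any other step keeps the head constructor, so the same redex fires in [Q] and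
    the step lives on in the continuation. *)
Lemma good_sc (Lab : finType) b N (P Q : proc Lab) M :
  good b N -> Permutation N (P :: M) -> sc P Q -> good b (Q :: M).
Proof.
move=> g; elim: g P Q M => {N} [|t n Xs Y M' N a pN g IH] P Q M p s.
  by have := Permutation_nil p.
have gN := good_perm p (good_act a pN g).
case: (perm_cat_cons (Permutation_trans (Permutation_sym pN) p)); last first.
  case=> M2 [pM' pM]; apply: (good_act (M := Q :: M2) a).
    apply: Permutation_trans (perm_mid _ _ _).
    exact/perm_skip/Permutation_sym.
  move=> tb Ys y; apply: good_perm (perm_mid _ _ _) _.
  apply: (IH tb Ys y (ren (addn n) P)); last exact: sc_ren.
  apply: Permutation_trans (perm_cat2 (Permutation_refl Ys) (perm_map2 _ pM')) _.
  exact/Permutation_sym/perm_mid.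
case=> Xs' [pX pM].
case: (sc_inv s) => [<- //|ax|ax|{}s]; first exact/(good_struct_ax _ M ax).
  exact/(good_struct_ax _ M ax).
have {}IH Ys P' Q' M2 : t || b -> Y Ys ->
    Permutation (Ys ++ map (ren (addn n)) M') (P' :: M2) -> sc P' Q' -> good b (Q' :: M2).
  by move=> tb y p' s'; apply: IH p' s'.
move=> {g pN gN p}.
case: a pX IH => [|P1 P2|P1|x a P1 P2|x L L0 B cL|x k P1 L L0 B hk] pX IH.
- by have [E _] := Permutation_length_1_inv pX; subst P.
- have [E E'] := Permutation_length_1_inv pX; subst P Xs'.
  rewrite map_ren_id // in IH.
  case: s => -[Q1 -> s]; apply/good_parE;
    apply: good_perm (perm_cat2 (Permutation_refl [:: _; _]) pM) _.
    exact: IH s.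
  apply: good_perm (Permutation.perm_swap _ _ _) _; apply: IH s => //.
  exact: Permutation.perm_swap.
- have [E E'] := Permutation_length_1_inv pX; subst P Xs'.
  case: s => Q1 -> s; apply/good_nuE.
  apply: good_perm (perm_skip _ (perm_map2 (@shift Lab) pM)) _.
  exact: IH s.
- rewrite map_ren_id // in IH.
  have [[E E']|[E E']] := Permutation_length_2_inv pX; subst P Xs';
    case: s => Q1 -> s.
    apply: (good_act (M := M') (act_com x a Q1 P2)).
      exact/perm_skip/Permutation_sym.
    by move=> tb _ <-; rewrite map_ren_id //; apply: IH s.
  apply: (good_act (M := M') (act_com x a P1 Q1)).
    apply: Permutation_trans (Permutation.perm_swap _ _ _).
    exact/perm_skip/Permutation_sym.
  move=> tb _ <-; rewrite map_ren_id //.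
  apply: good_perm (Permutation.perm_swap _ _ _) _.
  apply: (IH _ (inst a P2) _ _ tb erefl); last exact: sc_ren.
  exact: Permutation.perm_swap.
- rewrite map_ren_id // in IH.
  have [E E'] := Permutation_length_1_inv pX; subst P Xs'.
  case: s => B' -> s; apply: (good_act (M := M') (act_choice x L0 B' cL)).
    exact/perm_skip/Permutation_sym.
  move=> tb _ [k [hk <-]]; rewrite map_ren_id //.
  apply: (IH [:: _] (PSel1 x k (B k hk)) _ _ tb) => //;
    [by exists k, hk|exact: Permutation_refl|].
  by rewrite /PSel1; apply: sc_sel => _ _; apply: s.
- rewrite map_ren_id // in IH.
  have [[E E']|[E E']] := Permutation_length_2_inv pX; subst P Xs';
    case: s => Q1 -> s.
    (* Inversion returns an arbitrary family over [[set k]], while [act_label] expects a constant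
       one. *)
    rewrite PSel_set1.
    apply: (good_act (M := M') (act_label x (Q1 k (set11 k)) L0 B hk)).
      exact/perm_skip/Permutation_sym.
    by move=> tb _ <-; rewrite map_ren_id //; apply: IH (s _ _); [exact: tb|..].
  apply: (good_act (M := M') (act_label x P1 L0 Q1 hk)).
    apply: Permutation_trans (Permutation.perm_swap _ _ _).
    exact/perm_skip/Permutation_sym.
  move=> tb _ <-; rewrite map_ren_id //.
  apply: good_perm (Permutation.perm_swap _ _ _) _.
  apply: (IH _ (B k hk) _ _ tb erefl) => //.
  exact: Permutation.perm_swap.
Qed.

Lemma good_struct_equiv (Lab : finType) b (P Q : proc Lab) M :
  struct_equiv P Q -> good b (P :: M) <-> good b (Q :: M).
Proof.
elim=> {P Q} [P Q /struct_step_sc [s s']|P|P Q _ IH|P Q R _ IH1 _ IH2] //.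
- by split=> /good_sc; apply; first [exact: Permutation_refl|exact: s|exact: s'].
- by rewrite IH.
- by rewrite IH1.
Qed.

(** * Reductions of configurations *)

Lemma red_good_false (Lab : finType) b (P Q : proc Lab) M :
  red b P Q -> good false (P :: M).
Proof.
move=> r; elim: r M => {b P Q} [x a P Q|x L L0 P k hk cL|x k P L L0 Q hk|b P P' _ IH|
  b P P' Q _ IH|b P C S S' st _ _ _ _ IH] M.
- by apply/good_parE; apply: good_act (act_com x a P Q) (Permutation_refl _) _.
- by apply: good_act (act_choice x L0 P cL) (Permutation_refl _) _.
- by apply/good_parE; apply: good_act (act_label x P L0 Q hk) (Permutation_refl _) _.
- exact/good_nuE.
- exact/good_parE.
- exact/(good_struct_equiv _ M (structs_equiv st)).
Qed.

Lemma red_good_true (Lab : finType) b (P Q : proc Lab) M :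
  red b P Q -> good true (P :: M) -> race_free (pars (P :: M)) -> good true (Q :: M).
Proof.
have fwd (Xs Ys M' : seq (proc Lab)) Y : act false 0 Xs Y -> Y Ys ->
    good true (Xs ++ M') -> race_free (pars (Xs ++ M')) -> good true (Ys ++ M').
  move=> a y g rf; rewrite -[M'](@map_ren_id _ _ (addn 0)) //.
  by apply: good_fwd g a y (Permutation_refl _) _; right.
have rfpar P1 P2 M' : race_free (pars (PPar P1 P2 :: M')) ->
    race_free (pars [:: P1, P2 & M']).
  by move/(race_free_act (act_par P1 P2) erefl); rewrite map_ren_id.
move=> r; elim: r M => {b P Q} [x a P Q|x L L0 P k hk cL|x k P L L0 Q hk|b P P' _ IH|
  b P P' Q _ IH|b P C S S' st _ _ _ _ IH] M.
- move=> /good_parE g /rfpar rf; apply/good_parE.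
  exact: (fwd [:: _; _] [:: _; _] M _ (act_com x a P Q) erefl g rf).
- move=> g rf; apply: (fwd [:: _] [:: _] M _ (act_choice x L0 P cL) _ g rf).
  by exists k, hk.
- move=> /good_parE g /rfpar rf; apply/good_parE.
  exact: (fwd [:: _; _] [:: _; _] M _ (act_label x P L0 Q hk) erefl g rf).
- move=> /good_nuE g rf; apply/good_nuE/IH => //.
  exact: (race_free_act (act_nu P) erefl rf).
- by move=> /good_parE g /rfpar rf; apply/good_parE/IH.
- move=> /(good_struct_equiv _ M (structs_equiv st)) g rf; apply: IH => //.
  apply: race_free_structs rf; case: M {g} => [|R M] //.
  by rewrite !pars_cons; apply: structs_parL.
Qed.

Lemma good_false (Lab : finType) b (M : seq (proc Lab)) : good b M -> good false M.
Proof.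
elim=> {M} [|t n Xs Y M N a pN _ IH]; first exact: good_nil.
by apply: good_act a pN _; case: t IH => // IH _; apply: IH.
Qed.

Lemma structs_nus_nil (Lab : finType) n : structs (nus n (@PNil Lab)) PNil.
Proof.
elim: n => [|n IH]; first exact: structs_refl.
apply: structs_trans (structs_nus 1 IH) _; exact/structs_ax/(struct_nu0 PNil).
Qed.

Lemma reduces_nus (Lab : finType) n (P Q : proc Lab) :
  reduces P Q -> reduces (nus n P) (nus n Q).
Proof. by elim: n => //= n IH /IH; apply: reduces_nu. Qed.

Lemma good_progress (Lab : finType) (M : seq (proc Lab)) :
  good false M -> structs (pars M) PNil \/ exists Q, reduces (pars M) Q.
Proof.
elim=> {M} [|t n Xs Y M N a pN _ IH]; first by left; exact: structs_refl.
have sN := pars_perm pN.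
(* Here the label sets have to be nonempty: a choice without outcome would yield no reduction. *)
have [Ys y] : exists Ys, Y Ys.
  case: a {IH} => [|P Q|P|x a P Q|x L L0 P cL|x k P L L0 Q hk]; try by eexists.
  by have /set0Pn [k hk] := L0; exists [:: PSel1 x k (P k hk)], k, hk.
case: t a IH => a IH.
  have {}sN := structs_trans sN (act_structs M a y).
  case: (IH isT _ y) => [s|[Q r]].
    left; apply: structs_trans sN _.
    exact: structs_trans (structs_nus n s) (structs_nus_nil _ n).
  right; exists (nus n Q); apply: reduces_struct sN _; exact: reduces_nus.
have [_ [Z [Z' [s r _]]]] := act_red M a y.
by right; exists Z'; apply: reduces_intro r; apply: structs_trans s.
Qed.

Lemma good_deadlock_free (Lab : finType) (P : proc Lab) :
  race_free P -> good true [:: P] -> deadlock_free P.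
Proof.
move=> rf g [P' [/clos_rt_rt1n_iff r [nnil nred]]].
elim: r rf g nnil nred => {P P'} [P _ g nnil nred|P Q R [b r] _ IH rf g].
  have gf := good_false g.
  case: (good_progress gf) => //= /structs_equiv; exact: nnil.
apply: IH; last exact: red_good_true r g rf.
by apply: race_free_reduces rf; apply: rt_step; exists b.
Qed.

(** * Deadlock-free processes are good *)

(** Chosen so that every action, restructuring included, strictly decreases the total. A selection
    with several labels weighs one more than its singletons, to pay for Choice; the maximum bounds
    whichever branch is taken. *)
Fixpoint psize (Lab : finType) (P : proc Lab) : nat :=
  match P with
  | PNil => 1
  | POut _ _ P | PIn _ P | PNu P => (psize P).+1
  | PPar P Q => (psize P + psize Q).+1
  | PSel _ L _ P => (1 < #|L|) + (\max_(i < #|L|) psize (P _ (enum_valP i))).+1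
  | PBra _ L _ P => (\max_(i < #|L|) psize (P _ (enum_valP i))).+1
  end.

Lemma psize_ren (Lab : finType) (P : proc Lab) f : psize (ren f P) = psize P.
Proof.
elim: P f => [|x y P IH|x P IH|P IHP Q IHQ|P IH|x L L0 P IH|x L L0 P IH] f //=.
- by rewrite IH.
- by rewrite IH.
- by rewrite IHP IHQ.
- by rewrite IH.
- by congr (_ + _.+1); apply: eq_bigr.
- by congr _.+1; apply: eq_bigr.
Qed.

Lemma enum_family (Lab : finType) T (L : {set Lab}) (P : forall l, l \in L -> T) k hk :
  exists2 i : 'I_#|L|, enum_val i = k & P k hk = P _ (enum_valP i).
Proof.
have E := enum_rankK_in hk hk; exists (enum_rank_in hk k) => //.
by move: (enum_valP _); rewrite E => hk'; congr P; apply: bool_irrelevance.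
Qed.

Lemma psize_PSel1 (Lab : finType) x (k : Lab) P : psize (PSel1 x k P) = (psize P).+1.
Proof.
rewrite /= {1}cards1 /= add0n; congr _.+1; apply/eqP; rewrite eqn_leq.
apply/andP; split; first exact/bigmax_leqP.
by have [i _ _] := enum_family (fun _ _ => P) (set11 k);
  exact: (@leq_bigmax _ (fun=> psize P) i).
Qed.

Definition csize (Lab : finType) (M : seq (proc Lab)) := sumn (map (@psize Lab) M).

Lemma csize_cat (Lab : finType) (M N : seq (proc Lab)) :
  csize (M ++ N) = csize M + csize N.
Proof. by rewrite /csize map_cat sumn_cat. Qed.

Lemma csize_ren (Lab : finType) (M : seq (proc Lab)) f :
  csize (map (ren f) M) = csize M.
Proof.
by rewrite /csize -map_comp; congr sumn; apply: eq_map => P /=; rewrite psize_ren.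
Qed.

Lemma csize_perm (Lab : finType) (M N : seq (proc Lab)) :
  Permutation M N -> csize M = csize N.
Proof. by rewrite /csize; elim=> //= *; lia. Qed.

Lemma csize_act (Lab : finType) t n (Xs : seq (proc Lab)) Y Ys :
  act t n Xs Y -> Y Ys -> csize Ys < csize Xs.
Proof.
have leP x (L : {set Lab}) L0 (P : forall l, l \in L -> proc Lab) k hk :
    psize (P k hk) < psize (PBra x L0 P).
  by have [i _ ->] := enum_family P hk; rewrite ltnS; apply: (leq_bigmax i).
have cs1 (P : proc Lab) : csize [:: P] = psize P by rewrite /csize /= addn0.
have cs2 (P Q : proc Lab) : csize [:: P; Q] = psize P + psize Q.
  by rewrite /csize /= addn0.
case=> [|P Q|P|x a P Q|x L L0 P cL|x k P L L0 Q hk]; last 2 first.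
- move=> [k [hk <-]]; have := leP x L L0 P k hk.
  rewrite !cs1 psize_PSel1 /= cL; lia.
- move=> <-; have := leP x L L0 Q k hk.
  rewrite !cs2 psize_PSel1 /=; lia.
all: by move=> <-; rewrite ?cs1 ?cs2 /csize /inst /= ?psize_ren; lia.
Qed.

Lemma good_pars (Lab : finType) b (M : seq (proc Lab)) :
  good b [:: pars M] <-> good b M.
Proof.
suff H N : good b (pars M :: N) <-> good b (M ++ N) by rewrite H cats0.
elim: M N => [|P M IH] N; first exact: good_nilE.
case: M IH => [//|Q M] IH; rewrite pars_cons good_parE.
split=> [g|g].
  apply: good_perm (Permutation_sym (perm_mid P (Q :: M) N)) _; apply/IH.
  by apply: good_perm g; apply: Permutation.perm_swap.
apply: good_perm (Permutation.perm_swap _ _ _) _; apply/IH.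
by apply: good_perm g; apply: perm_mid P (Q :: M) N.
Qed.

Lemma good_nus (Lab : finType) b n (P : proc Lab) :
  good b [:: nus n P] <-> good b [:: P].
Proof. by elim: n => //= n IH; rewrite good_nuE. Qed.

Lemma deadlock_free_good_false (Lab : finType) (P : proc Lab) :
  deadlock_free P -> good false [:: P].
Proof.
move=> df; have [nilP|nnil] := classic (struct_equiv P PNil).
  by apply/(good_struct_equiv _ _ nilP)/good_nilE/good_nil.
have [[Q [b r]]|nred] := classic (exists Q, reduces P Q); first exact: red_good_false r.
by case: df; exists P; split; first exact: rt_refl.
Qed.

Lemma deadlock_free_reduces (Lab : finType) (P Q : proc Lab) :
  reduces P Q -> deadlock_free P -> deadlock_free Q.
Proof.
move=> r df [R [QR st]]; apply: df; exists R; split=> //.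
by apply: rt_trans QR; apply: rt_step.
Qed.

(** Not being stuck provides only one action, which becomes the head of the schedule. Each outcome
    is again reached from a deadlock-free process: the same [P] after a restructuring, a reduct of
    [P] otherwise. The restrictions opened so far are kept as the [k] binders. *)
Lemma deadlock_free_good (Lab : finType) (P : proc Lab) k M :
  deadlock_free P -> structs P (nus k (pars M)) -> good true M.
Proof.
move: {2}(csize M).+1 (ltnSn (csize M)) => m.
elim: m P k M => [//|m IH] P k M lt df s.
have /good_pars gM : good false [:: pars M].
  apply/(good_nus _ k)/(good_struct_equiv _ _ (structs_equiv s)).
  exact: deadlock_free_good_false.
case: gM lt s => [|t n Xs Y M' N a pN _] lt s; first exact: good_nil.
apply: (good_act a pN) => _ Ys y.
have sz : csize (Ys ++ map (ren (addn n)) M') < m.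
  rewrite (csize_perm pN) !csize_cat csize_ren in lt *.
  have := csize_act a y; lia.
have {}s := structs_trans s (structs_nus k (pars_perm pN)).
case: t a => a.
  apply: (IH _ (k + n) _ sz df); rewrite /nus iterD -!/(nus _ _).
  exact: structs_trans s (structs_nus k (act_structs M' a y)).
have [n0 [Z [Z' [s1 r s2]]]] := act_red M' a y.
have r' := reduces_intro (structs_trans s (structs_nus k s1)) (red_nus k r).
apply: (IH _ k _ sz (deadlock_free_reduces r' df)).
by subst n; rewrite map_ren_id //; apply: structs_nus.
Qed.

(** * Good configurations are provable *)

Definition vren (E : countType) (f : name -> name) (v : var E) : var E :=
  match v with inl n => inl (f n) | inr e => inr e end.

Lemma vup_vshift (E : countType) (f : var E -> var E) v :
  vup f (vshift v) = vshift (f v).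
Proof. by case: v. Qed.

Lemma vup_comp (E : countType) (f g : var E -> var E) :
  vup f \o vup g = vup (f \o g).
Proof.
by apply: functional_extensionality => -[[|n]|e] //=; rewrite vup_vshift.
Qed.

Lemma vup_vren (E : countType) f : vup (@vren E f) = vren (up f).
Proof. by apply: functional_extensionality => -[[|n]|e]. Qed.

Lemma fren_comp (Lab : finType) (E : countType) (A : form Lab E) f g :
  fren f (fren g A) = fren (f \o g) A.
Proof.
have tren_comp f' g' (t : term Lab E) : tren f' (tren g' t) = tren (f' \o g') t.
  by case: t.
elim: A f g => [|x t|x t|A IHA B IHB|A IHA B IHB|A IHA B IHB|n n0 A IH|n n0 A IH|
  A IH|A IH|q A IH] f g //=; rewrite ?tren_comp ?IHA ?IHB //.
- by congr FPlus; apply: functional_extensionality => i; rewrite IH.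
- by congr FWith; apply: functional_extensionality => i; rewrite IH.
- by rewrite IH vup_comp.
- by rewrite IH vup_comp.
- by rewrite IH vup_comp.
Qed.

Lemma fren_ext (Lab : finType) (E : countType) (A : form Lab E) f g :
  f =1 g -> fren f A = fren g A.
Proof. by move=> /functional_extensionality ->. Qed.

Lemma tr_ren (Lab : finType) (E : countType) (P : proc Lab) f :
  tr E (ren f P) = fren (vren f) (tr E P).
Proof.
elim: P f => [|x y P IH|x P IH|P IHP Q IHQ|P IH|x L L0 P IH|x L L0 P IH] f //=.
- by rewrite IH.
- by rewrite IH vup_vren.
- by rewrite IHP IHQ.
- by rewrite IH vup_vren.
- by congr FWith; apply: functional_extensionality => i; rewrite IH.
- by congr FPlus; apply: functional_extensionality => i; rewrite IH.
Qed.

Lemma not_free_large (Lab : finType) (E : countType) (A : form Lab E) :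
  exists n, forall m, n <= m -> ~ free (inl m) A.
Proof.
have lv (v : var E) : exists n, forall m, n <= m -> inl m <> v.
  by case: v => [n|e]; [exists n.+1 => m lt [E']; lia|exists 0].
have lt (x : var E) (t : term Lab E) : exists n, forall m, n <= m ->
    ~ (inl m = x \/ if t is TVar z then inl m = z else False).
  have [n Hn] := lv x; case: t => [z|l].
    have [n' Hn'] := lv z; exists (n + n') => m le [] ; [apply: Hn|apply: Hn']; lia.
  by exists n => m le [|//]; apply: Hn.
have l2 B C : (exists n, forall m, n <= m -> ~ free (inl m) B) ->
    (exists n, forall m, n <= m -> ~ @free Lab E (inl m) C) ->
    exists n, forall m, n <= m -> ~ (free (inl m) B \/ free (inl m) C).
  move=> [n Hn] [n' Hn']; exists (n + n') => m le [] ; [apply: Hn|apply: Hn']; lia.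
have lf n (B : 'I_n -> form Lab E) :
    (forall i, exists k, forall m, k <= m -> ~ free (inl m) (B i)) ->
    exists k, forall m, k <= m -> ~ exists i, free (inl m) (B i).
  move=> /fin_all_exists [k Hk]; exists (\max_i k i) => m le [i].
  by apply: Hk; apply: leq_trans le; apply: leq_bigmax.
have l1 B : (exists n, forall m, n <= m -> ~ free (inl m) B) ->
    exists n, forall m, n <= m -> ~ @free Lab E (vshift (inl m)) B.
  by move=> [n Hn]; exists n => m le; apply: Hn; rewrite leqW.
elim: A => [|x t|x t|A IHA B IHB|A IHA B IHB|A IHA B IHB|n n0 A IH|n n0 A IH|
  A IH|A IH|q A IH] /=; do ?[exact: lt | exact: l2 | exact: lf | exact: l1].
by exists 0 => m _ [].
Qed.

Lemma fresh_exists (Lab : finType) (E : countType) (G : seq (form Lab E)) :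
  exists y, fresh y G.
Proof.
suff [n Hn] : exists n, forall m, n <= m -> fresh (inl m) G.
  by exists (inl n); apply: Hn.
elim: G => [|A G [n Hn]]; first by exists 0.
have [n' Hn'] := not_free_large A; exists (n + n') => m le /=.
by split; [apply: Hn'|apply: Hn]; lia.
Qed.

Lemma Forall2_cat_inv T U (R : T -> U -> Prop) A B C :
  Forall2 R (A ++ B) C ->
  exists C1 C2, [/\ C = C1 ++ C2, Forall2 R A C1 & Forall2 R B C2].
Proof.
by move=> /(@Forall2_app_inv_l _ _ R A B) [C1 [C2 [? [? ->]]]]; exists C1, C2.
Qed.

Lemma Forall2_consE T U (R : T -> U -> Prop) x A C :
  Forall2 R (x :: A) C -> exists y C', [/\ C = y :: C', R x y & Forall2 R A C'].
Proof. by move=> H; inversion H; subst; do 2!eexists; split; eauto. Qed.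

Lemma Forall2_nilE T U (R : T -> U -> Prop) C : Forall2 R [::] C -> C = [::].
Proof. by move=> H; inversion H. Qed.

(* A selection whose label is already chosen may be replaced by its only
   branch, so that the [&] rule is applied once, when the choice is made. *)
Definition denotes (Lab : finType) (E : countType) (g : var E -> var E)
  (P : proc Lab) (A : form Lab E) : Prop :=
  A = fren g (tr E P) \/
  exists x k Q, P = PSel1 x k Q /\
    A = FPrec (FOut (g (inl x)) (TLab k)) (fren g (tr E Q)).

Definition vinst (E : countType) (y v : var E) : var E :=
  match v with inl 0 => y | inl m.+1 => inl m | inr e => inr e end.

Lemma vinst_shift (E : countType) (y v : var E) : vinst y (vshift v) = v.
Proof. by case: v. Qed.

Lemma finstE (Lab : finType) (E : countType) y (A : form Lab E) :
  finst y A = fren (vinst y) A.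
Proof. by []. Qed.

Lemma denotes_shift (Lab : finType) (E : countType) (g g' : var E -> var E)
  (P : proc Lab) A :
  (forall n, g' (inl n.+1) = g (inl n)) -> (forall e, g' (inr e) = g (inr e)) ->
  denotes g P A -> denotes g' (shift P) A.
Proof.
move=> gg1 gg2; have gE Q : fren g' (tr E (shift Q)) = fren g (tr E Q).
  by rewrite tr_ren fren_comp; apply: fren_ext => -[n|e] /=.
case=> [->|[x [k [Q [-> ->]]]]]; first by left; rewrite gE.
by right; exists x.+1, k, (shift Q); rewrite gE gg1.
Qed.

Lemma store_join0 (E : countType) : store_join (@store0 E) (@store0 E) (@store0 E).
Proof. by move=> v; left. Qed.

(** Names of the configuration shift whenever a restriction is opened, while variables of the
    sequent stay put; [g] relates the two. The empty configuration is set apart because the empty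
    sequent has no derivation. *)
Lemma good_pil (Lab : finType) (E : countType) (N : seq (proc Lab)) :
  good true N -> forall (g : var E -> var E) As, Forall2 (denotes g) N As ->
  N = [::] \/ pil process_rules (@store0 E) As.
Proof.
elim=> {N} [|t n Xs Y M N a pN _ IH] g As; first by left.
move=> /(Permutation_Forall2 pN) [As' [pA]] /Forall2_cat_inv [Xf [Mf [E' XX MM]]].
right; apply: pil_exch (Permutation_sym pA) _; subst As'; move: {pN pA} IH.
have dtr (g' : var E -> var E) P : denotes g' P (fren g' (tr E P)) by left.
rewrite orbT.
case: a XX => [|P Q|P|x a P Q|x L L0 P cL|x k P L L0 Q hk] XX IH.
- have [A [B [-> dA /Forall2_nilE ->]]] := Forall2_consE XX.
  case: dA => [->|[? [? [? []//]]]] /=.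
  have := IH isT _ erefl g Mf; rewrite map_ren_id // => /(_ MM) [/= M0|p].
    rewrite M0 in MM; rewrite (Forall2_nilE MM); exact: pil_unit.
  by apply: (pil_mix (G := [:: FUnit]) _ (@store_join0 E) _ p) => //; apply: pil_unit.
- have [A [B [-> dA /Forall2_nilE ->]]] := Forall2_consE XX.
  case: dA => [->|[? [? [? []//]]]] /=; apply: pil_par => //.
  have := IH isT _ erefl g [:: fren g (tr E P), fren g (tr E Q) & Mf].
  by rewrite map_ren_id // => -[|//|//]; do 2!apply: Forall2_cons => //.
- have [A [B [-> dA /Forall2_nilE ->]]] := Forall2_consE XX.
  case: dA => [->|[? [? [? []//]]]] /=.
  have [y fy] := fresh_exists (FNom New (fren (vup g) (tr E P)) :: Mf).
  apply: (pil_nomO (y := y)) => //; rewrite finstE fren_comp.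
  set g' := (X in fren X _).
  case: (IH isT _ erefl g' (fren g' (tr E P) :: Mf)) => //.
  apply: Forall2_cons => //.
  elim: MM => [|Q B' M' Mf' dQ _ IHM] /=; first exact: Forall2_nil.
  apply: Forall2_cons => //; apply: denotes_shift dQ => [m|e] /=.
    by rewrite /g' /= vinst_shift.
  by rewrite /g' /= vinst_shift.
- have [A1 [B1 [-> d1 XX']]] := Forall2_consE XX.
  have [A2 [B2 [-> d2 /Forall2_nilE ->]]] := Forall2_consE XX'.
  case: d1 => [->|[? [? [? []//]]]]; case: d2 => [->|[? [? [? []//]]]] /=.
  apply: pil_exch (Permutation.perm_swap _ _ _) _.
  apply: (pil_ex (y := g (inl a))) => //.
  apply: pil_exch (Permutation.perm_swap _ _ _) _.
  rewrite finstE /= vinst_shift fren_comp.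
  (* The two atoms close by the axiom alone, so the whole context accompanies the continuations. *)
  apply: (pil_prec (G := [::]) _ (@store_join0 E)) => //; first exact: pil_ax.
  have := IH isT _ erefl g [:: fren g (tr E P), fren g (tr E (inst a Q)) & Mf].
  rewrite map_ren_id // tr_ren fren_comp.
  have -> : fren (g \o vren (fun n => if n is m.+1 then m else a)) (tr E Q) =
      fren (vinst (g (inl a)) \o vup g) (tr E Q).
    by apply: fren_ext => -[[|m]|e] //=; rewrite vinst_shift.
  case=> //; apply: Forall2_cons => //; apply: Forall2_cons => //.
  left; rewrite tr_ren fren_comp; apply: fren_ext => -[[|m]|e] //=;
  by rewrite vinst_shift.
- have [A [B [-> dA /Forall2_nilE ->]]] := Forall2_consE XX.
  case: dA => [->|[x' [k' [Q []]]]]; last first.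
    by case/PSel_inj => _ E' _; move: cL; rewrite E' cards1.
  apply: pil_with => // i.
  have := IH isT _ (ex_intro _ _ (ex_intro _ (enum_valP i) erefl)) g.
  rewrite map_ren_id // => {}IH.
  case: (IH (FPrec (FOut (g (inl x)) (TLab (enum_val i)))
           (fren g (tr E (P _ (enum_valP i)))) :: Mf)) => //.
  apply: Forall2_cons => //; right.
  by exists x, (enum_val i), (P _ (enum_valP i)).
- have [A1 [B1 [-> d1 XX']]] := Forall2_consE XX.
  have [A2 [B2 [-> d2 /Forall2_nilE ->]]] := Forall2_consE XX'.
  case: d2 => [->|[? [? [? []//]]]].
  have [i ik Qi] := enum_family Q hk.
  suff p : pil process_rules (@store0 E)
      [:: FPrec (FOut (g (inl x)) (TLab k)) (fren g (tr E P)),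
          fren g (tr E (PBra x L0 Q)) & Mf].
    (* The sender may still carry its one-branch [FWith], if it was a singleton from the start; that
       is removed here. *)
    case: d1 => [->|[x' [k' [P' [/PSel1_inj [<- <- <-] -> //]]]]].
    apply: pil_with => // j; suff -> : enum_val j = k by [].
    by apply/set1P/enum_valP.
  apply: pil_exch (Permutation.perm_swap _ _ _) _.
  apply: (@pil_plus _ _ _ _ _ _ _ _ i) => //=; rewrite -Qi ik.
  apply: pil_exch (Permutation.perm_swap _ _ _) _.
  apply: (pil_prec (G := [::]) _ (@store_join0 E)) => //; first exact: pil_ax.
  have := IH isT _ erefl g [:: fren g (tr E P), fren g (tr E (Q k hk)) & Mf].
  by rewrite map_ren_id // => -[|//|//]; do 2!apply: Forall2_cons => //.
Qed.

(** * Schedules of atoms and prefixes *)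

(* A process, or a prefix with a fixed object whose continuation is [K]; for a
   bare atom [K] is empty. *)
Inductive item (Lab : finType) : Type :=
| IProc (P : proc Lab)
| IAct (o : bool) (x : name) (t : name + Lab) (K : seq (proc Lab)).

Definition oren (Lab : finType) f (t : name + Lab) : name + Lab :=
  match t with inl a => inl (f a) | inr l => inr l end.

Definition iren (Lab : finType) f (i : item Lab) : item Lab :=
  match i with
  | IProc P => IProc (ren f P)
  | IAct o x t K => IAct o (f x) (oren f t) (map (ren f) K)
  end.

Lemma iren_comp (Lab : finType) (i : item Lab) f g :
  iren f (iren g i) = iren (f \o g) i.
Proof. by case: i => [P|o x [a|l] K] /=; rewrite ?ren_comp ?map_ren_comp. Qed.

Lemma iren_id (Lab : finType) (i : item Lab) f : f =1 id -> iren f i = i.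
Proof.
move=> ff; case: i => [P|o x [a|l] K] /=; rewrite ?ren_idE ?map_ren_id ?ff //.
Qed.

Lemma map_iren_id (Lab : finType) (M : seq (item Lab)) f :
  f =1 id -> map (iren f) M = M.
Proof. by move=> ff; elim: M => //= i M ->; rewrite iren_id. Qed.

(** These actions follow the rules of the calculus, not reduction: opening an input or an offer
    guesses its object or branch, as the existential and sum rules do, and [iact_cut] with empty
    continuations is the axiom. *)
Inductive iact (Lab : finType) :
  nat -> seq (item Lab) -> (seq (item Lab) -> Prop) -> Prop :=
| iact_nil : iact 0 [:: IProc PNil] (eq [::])
| iact_par P Q : iact 0 [:: IProc (PPar P Q)] (eq [:: IProc P; IProc Q])
| iact_nu P : iact 1 [:: IProc (PNu P)] (eq [:: IProc P])
| iact_out x a P :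
    iact 0 [:: IProc (POut x a P)] (eq [:: IAct true x (inl a) [:: P]])
| iact_in x a P :
    iact 0 [:: IProc (PIn x P)] (eq [:: IAct false x (inl a) [:: inst a P]])
| iact_sel x (L : {set Lab}) (L0 : L != set0) P :
    iact 0 [:: IProc (PSel x L0 P)]
      (fun Ys => exists k hk, [:: IAct true x (inr k) [:: P k hk]] = Ys)
| iact_bra x (L : {set Lab}) (L0 : L != set0) P k (hk : k \in L) :
    iact 0 [:: IProc (PBra x L0 P)] (eq [:: IAct false x (inr k) [:: P k hk]])
| iact_cut x t K K' :
    iact 0 [:: IAct true x t K; IAct false x t K'] (eq (map (@IProc Lab) (K ++ K'))).

Lemma iact_ren (Lab : finType) n (Xs : seq (item Lab)) Y g : iact n Xs Y ->
  exists2 Y', iact n (map (iren g) Xs) Y' &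
    forall Zs, Y' Zs -> exists2 Ys, Y Ys & Zs = map (iren (upn n g)) Ys.
Proof.
case=> [|P Q|P|x a P|x a P|x L L0 P|x L L0 P k hk|x t K K'] /=.
- by eexists; first exact: iact_nil; move=> _ <-; eexists.
- by eexists; first exact: iact_par; move=> _ <-; eexists.
- by eexists; first exact: iact_nu; move=> _ <-; eexists.
- by eexists; first exact: iact_out; move=> _ <-; eexists.
- eexists; first exact: (iact_in (g x) (g a)); move=> _ <-; eexists=> //=.
  by rewrite ren_inst.
- eexists; first exact: iact_sel; move=> _ [k [hk <-]].
  by eexists; first by exists k, hk.
- by eexists; first exact: (@iact_bra _ _ _ _ _ _ hk); move=> _ <-; eexists.
- eexists; first exact: iact_cut; move=> _ <-; eexists=> //=.
  by rewrite -map_cat -!map_comp; apply: eq_map.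
Qed.

Inductive igood (Lab : finType) : seq (item Lab) -> Prop :=
| igood_nil : igood [::]
| igood_act n Xs Y M N : iact n Xs Y -> Permutation N (Xs ++ M) ->
    (forall Ys, Y Ys -> igood (Ys ++ map (iren (addn n)) M)) -> igood N.

Lemma igood_perm (Lab : finType) (M N : seq (item Lab)) :
  Permutation M N -> igood M -> igood N.
Proof.
move=> p g; case: g p => [/Permutation_nil ->|]; first exact: igood_nil.
move=> n Xs Y M' N' a pN IH p; apply: igood_act a _ IH.
by apply: Permutation_trans pN; apply: Permutation_sym.
Qed.

Lemma igood_ren (Lab : finType) (N : seq (item Lab)) :
  igood N -> forall g, igood (map (iren g) N).
Proof.
elim=> {N} [|n Xs Y M N a p _ IH] g; first exact: igood_nil.
have [Y' a' Y'Y] := iact_ren g a.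
apply: (igood_act (M := map (iren g) M) a').
  by rewrite -map_cat; apply: perm_map2.
move=> Zs /Y'Y [Ys yY ->]; have := IH Ys yY (upn n g).
rewrite map_cat -!map_comp; congr (igood (_ ++ _)).
apply: eq_map => i /=; rewrite !iren_comp; congr iren.
by apply: functional_extensionality => j /=; rewrite upn_add.
Qed.

Lemma igood_step (Lab : finType) X Ys (M : seq (item Lab)) :
  iact 0 [:: X] (eq Ys) -> igood (Ys ++ M) -> igood (X :: M).
Proof.
move=> a g; apply: (igood_act (M := M) a); first exact: Permutation_refl.
by move=> _ <-; rewrite map_iren_id.
Qed.

Definition extend (Lab : finType) (p : item Lab * seq (proc Lab)) : item Lab :=
  match p.1 with IProc P => IProc P | IAct o x t K => IAct o x t (K ++ p.2) end.

(** Extra continuations wait for a communication, so they can only be attached to a prefix. *)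
Definition extendable (Lab : finType) (p : item Lab * seq (proc Lab)) : Prop :=
  match p.1 with IProc _ => p.2 = [::] | IAct _ _ _ _ => True end.

Definition plain (Lab : finType) (i : item Lab) : item Lab * seq (proc Lab) :=
  (i, [::]).

Lemma extend_plain (Lab : finType) (M : seq (item Lab)) :
  map (@extend Lab) (map (@plain Lab) M) = M.
Proof. by elim: M => //= -[P|o x t K] M -> //=; rewrite /extend /= cats0. Qed.

Lemma flatten_plain (Lab : finType) (M : seq (item Lab)) :
  flatten (map snd (map (@plain Lab) M)) = [::].
Proof. by elim: M. Qed.

Lemma fst_plain (Lab : finType) (M : seq (item Lab)) :
  map fst (map (@plain Lab) M) = M.
Proof. by elim: M => //= i M ->. Qed.

Lemma extendable_plain (Lab : finType) (M : seq (item Lab)) :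
  Forall (@extendable Lab) (map (@plain Lab) M).
Proof. by elim: M => [|[P|o x t K] M IH] /=; constructor. Qed.

Lemma Forall_perm T (R : T -> Prop) A B :
  Permutation A B -> Forall R A -> Forall R B.
Proof. by move=> p; rewrite p. Qed.

Lemma Forall_catE T (R : T -> Prop) A B :
  Forall R (A ++ B) <-> Forall R A /\ Forall R B.
Proof. exact: Forall_app. Qed.

Lemma flatten_perm T (A B : seq (seq T)) :
  Permutation A B -> Permutation (flatten A) (flatten B).
Proof.
elim=> {A B} [|x A B _ IH|x y A|A B C _ IH1 _ IH2] /=.
- exact: Permutation_refl.
- exact: perm_cat2.
- exact: perm_catCA.
- exact: Permutation_trans IH1 IH2.
Qed.

Lemma extend_id (Lab : finType) (z : seq (item Lab * seq (proc Lab))) :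
  flatten (map snd z) = [::] -> map (@extend Lab) z = map fst z.
Proof.
elim: z => //= -[i [|//]] z IH /= /IH ->.
by case: i => [P|o x t K]; rewrite /extend /= ?cats0.
Qed.

Lemma extend_ren (Lab : finType) f (z : seq (item Lab * seq (proc Lab))) :
  exists z', [/\ map fst z' = map (iren f) (map fst z),
    map (@extend Lab) z' = map (iren f) (map (@extend Lab) z),
    flatten (map snd z') = map (ren f) (flatten (map snd z)) &
    Forall (@extendable Lab) z -> Forall (@extendable Lab) z'].
Proof.
exists (map (fun p => (iren f p.1, map (ren f) p.2)) z); split.
- by rewrite -!map_comp.
- rewrite -!map_comp; apply: eq_map => -[[P|o x t K] w] //=.
  by rewrite /extend /= map_cat.
- by rewrite map_flatten -!map_comp.
- elim: z => [|[i w] z IH] /= e; first exact: Forall_nil.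
  inversion e; subst; apply: Forall_cons; last exact: IH.
  by case: i {e} H1 => //= P; rewrite /extendable /= => ->.
Qed.

(* The processes guarded by the extended prefixes are released one by one as
   these are consumed, and pile up in [D]. *)
Lemma igood_graft (Lab : finType) N (z : seq (item Lab * seq (proc Lab))) D :
  igood N -> Permutation N (map fst z) -> Forall (@extendable Lab) z ->
  igood (map (@IProc Lab) (flatten (map snd z)) ++ D) ->
  igood (map (@extend Lab) z ++ D).
Proof.
move=> g; elim: g z D => {N} [|n Xs Y M N a pN _ IH] z D p ez gD.
  by move: p gD => /Permutation_nil; case: z {ez}.
have [z' [Ez pz]] := Permutation_map_inv _ _
  (Permutation_trans (Permutation_sym pN) p).
have {}Ez : Xs ++ M = map fst z' := Ez.
have {}gD : igood (map (@IProc Lab) (flatten (map snd z')) ++ D).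
  apply: igood_perm gD; apply: perm_cat2 (Permutation_refl D).
  exact/perm_map2/flatten_perm/perm_map2.
apply: (igood_perm (perm_cat2 (perm_map2 _ (Permutation_sym pz)) (Permutation_refl D))).
have {}ez := Forall_perm pz ez; move: {pN p pz z} ez gD.
have [zx [zm [-> EX EM]]] : exists zx zm,
    [/\ z' = zx ++ zm, Xs = map fst zx & M = map fst zm].
  exists (take (size Xs) z'), (drop (size Xs) z').
  by rewrite cat_take_drop map_take map_drop -Ez take_size_cat // drop_size_cat.
rewrite !map_cat flatten_cat map_cat -!catA => /Forall_catE [ex em] gD.
have [zm' [fm xm sm em']] := extend_ren (addn n) zm.
(* If the consumed items guard nothing extra, the same action applies. Otherwise it must be a cut,
   since every other action consumes a single unextended process. *)
have [s0|s1] := classic (flatten (map snd zx) = [::]).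
  rewrite (extend_id s0) -EX.
  apply: (igood_act a (Permutation_refl _)) => Ys y; rewrite map_cat -xm.
  have := IH Ys y (map (@plain Lab) Ys ++ zm') (map (iren (addn n)) D).
  rewrite !map_cat fst_plain extend_plain flatten_cat flatten_plain fm -EM sm /= -catA; apply.
  - exact: Permutation_refl.
  - by apply/Forall_catE; split; [exact: extendable_plain|exact: em'].
  - by have := igood_ren gD (addn n); rewrite s0 /= map_cat -!map_comp.
have single i : [:: i] = map fst zx -> (exists P, i = IProc P) -> False.
  case: zx s1 ex {EX gD} => [//|[j w] [|//]] /= s1 ex [E] [P E']; apply: s1.
  by inversion ex as [|? ? e]; subst; rewrite /extendable /= in e; rewrite e.
case: a EX IH fm xm sm => [|P Q|P|x a P|x a P|x L L0 P|x L L0 P k hk|x t K K']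
  EX IH fm xm sm;
  try by case: (single _ EX); eexists.
case: zx EX {s1 ex single} gD => [|[j w] [|[j' w'] [|//]]] //= [<- <-].
rewrite cats0 => gD.
apply: (igood_act (iact_cut x t (K ++ w) (K' ++ w')) (Permutation_refl _)) => _ <-.
rewrite [map (iren _) _]map_cat -xm (@map_iren_id _ D) //.
have [U EU] : exists U, map (@IProc Lab) (K ++ K') = U by eexists.
(* The cut releases [w] and [w'], which join [D]; the remaining obligation is the old one up to
   exchange. *)
have := IH _ EU (map (@plain Lab) U ++ zm')
  (map (@IProc Lab) (w ++ w') ++ D).
rewrite !map_cat !fst_plain !extend_plain flatten_cat flatten_plain fm -EM sm /= -EU => H.
apply: igood_perm (H _ _ _).
- rewrite map_cat -!catA; apply: perm_cat2; first exact: Permutation_refl.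
  rewrite (catA (map _ K')); apply: Permutation_trans (perm_catCA _ _ _) _.
  rewrite -!catA; do 2!(apply: perm_cat2; first exact: Permutation_refl).
  exact: perm_catCA.
- exact: Permutation_refl.
- by apply/Forall_catE; split; [exact: extendable_plain|exact: em'].
- rewrite map_ren_id // -map_cat catA; apply: igood_perm gD; rewrite catA.
  by apply: perm_cat2 (Permutation_refl D); apply: perm_catC.
Qed.

(** An opened prefix stands for the process from which it was opened. A guessed object or branch
    leaves no trace there, so opening an input or an offer costs no action and the guess is checked
    only at the cut. *)
Inductive realizes (Lab : finType) : item Lab -> proc Lab -> Prop :=
| real_proc P : realizes (IProc P) P
| real_out x a P : realizes (IAct true x (inl a) [:: P]) (POut x a P)
| real_in x a P : realizes (IAct false x (inl a) [:: inst a P]) (PIn x P)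
| real_sel x k P : realizes (IAct true x (inr k) [:: P]) (PSel1 x k P)
| real_bra x (L : {set Lab}) (L0 : L != set0) P k (hk : k \in L) :
    realizes (IAct false x (inr k) [:: P k hk]) (PBra x L0 P).

Lemma realizes_ren (Lab : finType) f (i : item Lab) P :
  realizes i P -> realizes (iren f i) (ren f P).
Proof.
case=> {i P} [P|x a P|x a P|x k P|x L L0 P k hk] /=.
- exact: real_proc.
- exact: real_out.
- rewrite ren_inst; exact: real_in.
- exact: real_sel.
- exact: (@real_bra _ _ _ _ (fun l hl => ren f (P l hl)) k hk).
Qed.

Lemma igood_good (Lab : finType) (N : seq (item Lab)) M :
  igood N -> Forall2 (@realizes Lab) N M -> good true M.
Proof.
move=> g; elim: g M => {N} [|n Xs Y M N a pN _ IH] M'.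
  by move/Forall2_nilE->; exact: good_nil.
move=> /(Permutation_Forall2 pN) [As [pA]] /Forall2_cat_inv [Xf [Mf [E' XX MM]]].
apply: good_perm (Permutation_sym pA) _; subst As; move: {pN pA} IH.
have {}MM : Forall2 (@realizes Lab) (map (iren (addn n)) M) (map (ren (addn n)) Mf).
  by elim: MM => //= *; constructor=> //; apply: realizes_ren.
case: a XX MM => [|P Q|P|x a P|x a P|x L L0 P|x L L0 P k hk|x t K K'] XX MM IH;
  have [A [B [-> dA XX']]] := Forall2_consE XX; last first.
  have [A' [B' [-> dA' /Forall2_nilE ->]]] := Forall2_consE XX'.
  have {}IH := IH _ erefl.
  inversion dA; subst; inversion dA'; subst.
    apply: (good_act (act_com _ _ _ _) (Permutation_refl _)) => _ _ <-.
    by apply: IH; do 2!(apply: Forall2_cons; first exact: real_proc).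
  apply: (good_act (act_label _ _ _ _ _) (Permutation_refl _)) => _ _ <-.
  by apply: IH; do 2!(apply: Forall2_cons; first exact: real_proc).
all: rewrite (Forall2_nilE XX') in XX *; inversion dA; subst; move: {dA XX XX'} IH MM.
- rewrite map_ren_id // => IH MM; apply: IH erefl _ _.
  by apply: Forall2_cons MM; apply: real_bra.
(* With several labels, opening a selection is a Choice; with one label the selection already has
   its chosen form. *)
- rewrite map_ren_id // => IH MM; have [cL|cL] := ltnP 1 #|L|.
    apply: (good_act (act_choice x L0 P cL) (Permutation_refl _)) => _ _ [k [hk <-]].
    rewrite map_ren_id //; apply: (IH _ (ex_intro _ k (ex_intro _ hk erefl))).
    by apply: Forall2_cons MM; apply: real_sel.
  have /cards1P [k Lk] : #|L| == 1 by rewrite eqn_leq cL card_gt0.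
  subst L; rewrite PSel_set1.
  apply: (IH _ (ex_intro _ k (ex_intro _ (set11 k) erefl))).
  by apply: Forall2_cons MM; apply: real_sel.
- rewrite map_ren_id // => IH MM; apply: IH erefl _ _.
  by apply: Forall2_cons MM; apply: real_in.
- rewrite map_ren_id // => IH MM; apply: IH erefl _ _.
  by apply: Forall2_cons MM; apply: real_out.
- move=> IH MM; apply/good_nuE/(IH _ erefl).
  by apply: Forall2_cons MM; apply: real_proc.
- rewrite map_ren_id // => IH MM; apply/good_parE/(IH _ erefl).
  by do 2!(apply: Forall2_cons; first exact: real_proc).
- by rewrite map_ren_id // => IH MM; apply/good_nilE/(IH _ erefl).
Qed.

(** * Provable sequents are good *)

Definition obj (Lab : finType) (E : countType) (f : var E -> name)
  (t : term Lab E) : name + Lab :=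
  match t with TVar v => inl (f v) | TLab l => inr l end.

(** [g] records how the binders above have been instantiated, and [f] the name each variable
    currently denotes. Atoms and prefixes have clauses of their own because the rules detach them
    from the formulas of processes. *)
Inductive reads (Lab : finType) (E : countType) (f : var E -> name) :
  form Lab E -> item Lab -> Prop :=
| reads_proc (g : var E -> var E) P :
    reads f (fren g (tr E P)) (IProc (ren (fun n => f (g (inl n))) P))
| reads_out x t : reads f (FOut x t) (IAct true (f x) (obj f t) [::])
| reads_in x t : reads f (FIn x t) (IAct false (f x) (obj f t) [::])
| reads_prec_out x t (g : var E -> var E) P :
    reads f (FPrec (FOut x t) (fren g (tr E P)))
      (IAct true (f x) (obj f t) [:: ren (fun n => f (g (inl n))) P])
| reads_prec_in x t (g : var E -> var E) P :
    reads f (FPrec (FIn x t) (fren g (tr E P)))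
      (IAct false (f x) (obj f t) [:: ren (fun n => f (g (inl n))) P]).

Lemma ren_free (Lab : finType) (E : countType) (P : proc Lab) (g : var E -> var E)
    (f f' : var E -> name) :
  (forall v, free v (fren g (tr E P)) -> f v = f' v) ->
  ren (fun n => f (g (inl n))) P = ren (fun n => f' (g (inl n))) P.
Proof.
have under (h h' : var E -> name) (g' : var E -> var E) (Q : proc Lab) :
    (forall (g : var E -> var E) (f f' : var E -> name),
      (forall v, free v (fren g (tr E Q)) -> f v = f' v) ->
      ren (fun n => f (g (inl n))) Q = ren (fun n => f' (g (inl n))) Q) ->
    (forall v, free (vshift v) (fren (vup g') (tr E Q)) -> h v = h' v) ->
    ren (up (fun n => h (g' (inl n)))) Q = ren (up (fun n => h' (g' (inl n)))) Q.
  move=> IH hh'; pose k (h : var E -> name) (v : var E) : name :=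
    match v with inl 0 => 0 | inl m.+1 => (h (inl m)).+1 | inr e => (h (inr e)).+1 end.
  have kE h0 : ren (up (fun n => h0 (g' (inl n)))) Q =
      ren (fun n => k h0 (vup g' (inl n))) Q.
    by apply: ren_ext => -[|n] //=; case: (g' (inl n)).
  rewrite !kE; apply: IH => -[[|m]|e] //= fv.
    by rewrite (hh' (inl m)).
  by rewrite (hh' (inr e)).
elim: P g f f' => [|x y P IH|x P IH|P IHP Q IHQ|P IH|x L L0 P IH|x L L0 P IH]
  g f f' ff' //=.
- rewrite (IH g f f') => [|v fv]; last by apply: ff'; right.
  by rewrite !ff' //=; left; [right|left].
- rewrite (under f f' g P IH) => [|v fv]; last by apply: ff'; right.
  by rewrite ff' //=; left; left.
- rewrite (IHP g f f') => [|v fv]; last by apply: ff'; left.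
  by rewrite (IHQ g f f') // => v fv; apply: ff'; right.
- by rewrite (under f f' g P IH).
(* The subject occurs only inside the branches of the translation, so a branch is needed to see that
   it is free. *)
- have /set0Pn [k hk] := L0; have [i _ _] := enum_family P hk.
  rewrite ff' /=; last by exists i; left; left.
  congr PSel; apply: functional_extensionality_dep => l.
  apply: functional_extensionality_dep => hl.
  apply: (IH l hl g f f') => v fv; apply: (ff' v).
  by have [j _ E'] := enum_family P hl; exists j; right; rewrite -E'.
- have /set0Pn [k hk] := L0; have [i _ _] := enum_family P hk.
  rewrite ff' /=; last by exists i; left; left.
  congr PBra; apply: functional_extensionality_dep => l.
  apply: functional_extensionality_dep => hl.
  apply: (IH l hl g f f') => v fv; apply: (ff' v).
  by have [j _ E'] := enum_family P hl; exists j; right; rewrite -E'.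
Qed.

Lemma reads_ren (Lab : finType) (E : countType) (f f' : var E -> name) h
    (A : form Lab E) i :
  (forall v, free v A -> f' v = h (f v)) -> reads f A i -> reads f' A (iren h i).
Proof.
move=> + r; case: r => {A i} [g P|x t|x t|x t g P|x t g P] ff' /=.
- rewrite ren_comp -(ren_free (f := f') (f' := h \o f) ff'); exact: reads_proc.
- have -> : oren h (obj f t) = obj f' t.
    by case: t ff' => //= v ->; last by right.
  rewrite -ff'; [exact: reads_out|by left].
- have -> : oren h (obj f t) = obj f' t.
    by case: t ff' => //= v ->; last by right.
  rewrite -ff'; [exact: reads_in|by left].
- have -> : oren h (obj f t) = obj f' t.
    by case: t ff' => //= v ->; last by left; right.
  rewrite -ff'; last by left; left.
  rewrite ren_comp -(ren_free (f := f') (f' := h \o f)); first exact: reads_prec_out.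
  by move=> v fv; apply: ff'; right.
- have -> : oren h (obj f t) = obj f' t.
    by case: t ff' => //= v ->; last by left; right.
  rewrite -ff'; last by left; left.
  rewrite ren_comp -(ren_free (f := f') (f' := h \o f)); first exact: reads_prec_in.
  by move=> v fv; apply: ff'; right.
Qed.

(** Each clause has the form consumed by the rule for that connective. A prefix may come from an
    unopened output or be opened already; the implication between [igood] statements treats both
    alike. *)
Lemma reads_inv (Lab : finType) (E : countType) (f : var E -> name) (A : form Lab E) i :
  reads f A i ->
  match A with
  | FUnit => i = IProc PNil
  | FOut x t => i = IAct true (f x) (obj f t) [::]
  | FIn x t => i = IAct false (f x) (obj f t) [::]
  | FPar A B => exists P Q,
      [/\ i = IProc (PPar P Q), reads f A (IProc P) & reads f B (IProc Q)]
  | FPrec A B => exists o x t P, [/\ reads f A (IAct o x t [::]), reads f B (IProc P) &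
      forall N, igood (IAct o x t [:: P] :: N) -> igood (i :: N)]
  | FPlus n _ A => exists x (L : {set Lab}) (L0 : L != set0) P, i = IProc (PBra x L0 P) /\
      forall j, exists k hk, reads f (A j) (IAct false x (inr k) [:: P k hk])
  | FWith n _ A => exists x (L : {set Lab}) (L0 : L != set0) P, i = IProc (PSel x L0 P) /\
      forall k hk, exists j, reads f (A j) (IAct true x (inr k) [:: P k hk])
  | FEx A => exists x P, i = IProc (PIn x P) /\
      forall y, reads f (finst y A) (IAct false x (inl (f y)) [:: inst (f y) P])
  | FNom q A => q = New /\ exists P, i = IProc (PNu P) /\
      forall y f', f' y = 0 -> (forall v, free v (FNom q A) -> f' v = (f v).+1) ->
      reads f' (finst y A) (IProc P)
  | FTens _ _ | FAll _ => False
  end.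
Proof.
case=> {A i} [g P|x t|x t|x t g P|x t g P] //; last 2 first.
- by do 4!eexists; split; [exact: reads_out|exact: reads_proc|].
- by do 4!eexists; split; [exact: reads_in|exact: reads_proc|].
case: P => [|x y P|x P|P Q|P|x L L0 P|x L L0 P] //=.
- do 4!eexists; split; [exact: reads_out|exact: reads_proc|] => N.
  exact: igood_step (iact_out _ _ _).
- do 2!eexists; split; first by [].
  move=> y; rewrite finstE /= vinst_shift fren_comp /inst ren_comp.
  have -> : ren ((fun n => if n is m.+1 then m else f y) \o up (fun n => f (g (inl n)))) P =
      ren (fun n => f ((vinst y \o vup g) (inl n))) P.
    by apply: ren_ext => -[|n] //=; rewrite vinst_shift.
  exact: (reads_prec_in f (g (inl x)) (TVar y)).
- by do 2!eexists; split; [by []|exact: reads_proc|exact: reads_proc].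
- split=> //; eexists; split; first by [].
  move=> y f' f'y f'f; rewrite finstE fren_comp.
  pose k (v : var E) : name :=
    match v with inl 0 => 0 | inl m.+1 => (f (inl m)).+1 | inr e => (f (inr e)).+1 end.
  have -> : ren (up (fun n => f (g (inl n)))) P = ren (fun n => k (vup g (inl n))) P.
    by apply: ren_ext => -[|n] //=; case: (g (inl n)).
  rewrite -(ren_free (f := f' \o vinst y) (f' := k)); first exact: reads_proc.
  move=> [[|m]|e] //= fv; apply: f'f; exact: fv.
- do 4!eexists; split; first by [].
  move=> l hl; have [j jl ->] := enum_family P hl; exists j.
  rewrite -jl; exact: (reads_prec_out f (g (inl x)) (TLab (enum_val j))).
- do 4!eexists; split; first by [].
  move=> j; exists (enum_val j), (enum_valP j).
  exact: (reads_prec_in f (g (inl x)) (TLab (enum_val j))).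
Qed.

Lemma store_join_noYa (E : countType) (S1 S2 S : store E) :
  store_join S1 S2 S -> (forall v, S v <> Some Ya) ->
  (forall v, S1 v <> Some Ya) /\ (forall v, S2 v <> Some Ya).
Proof.
move=> J noY; split=> v; case: (J v) => -[E1 E2]; rewrite ?E1 -?E2 //.
Qed.

Lemma igood_graft_plain (Lab : finType) (z : seq (item Lab * seq (proc Lab))) M D :
  Forall (@extendable Lab) z -> igood (map fst z ++ M) ->
  igood (map (@IProc Lab) (flatten (map snd z)) ++ D) ->
  igood (map (@extend Lab) z ++ M ++ D).
Proof.
move=> ez gM gD.
have := @igood_graft _ (map fst z ++ M) (z ++ map (@plain Lab) M) D gM.
rewrite !map_cat fst_plain extend_plain flatten_cat flatten_plain cats0 -catA; apply=> //.
by apply/Forall_catE; split=> //; exact: extendable_plain.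
Qed.

(* Only [New] is ever loaded, so that no [New] formula can pop a variable; all
   other uses of the store are irrelevant. *)
Lemma pil_igood (Lab : finType) (E : countType) R (S : store E) (As : seq (form Lab E)) :
  pil R S As -> (forall v, S v <> Some Ya) ->
  forall f N, Forall2 (reads f) As N -> igood N.
Proof.
(* Common to the two rules that introduce a fresh name: [y] is read as index 0 and all other
   variables are shifted, which is sound since [y] is fresh. *)
have nu (q : nominal) (A : form Lab E) (G : seq (form Lab E)) y f N :
    fresh y (FNom q A :: G) ->
    (q = New -> forall f N, Forall2 (reads f) (finst y A :: G) N -> igood N) ->
    Forall2 (reads f) (FNom q A :: G) N -> igood N.
  move=> fr IH HF; have [i [N' [-> r rG]]] := Forall2_consE HF.
  have [fA fG] : ~ free y (FNom q A) /\ fresh y G := fr.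
  have [qN [P [-> rP]]] := reads_inv r.
  apply: (igood_act (iact_nu P) (Permutation_refl _)) => _ <-.
  pose f' v := if v == y then 0 else (f v).+1.
  have f'E v : v <> y -> f' v = (f v).+1 by rewrite /f'; case: eqP.
  apply: (IH qN f'); apply: Forall2_cons.
    apply: rP => [|v fv]; first by rewrite /f' eqxx.
    by apply: f'E => vy; subst v.
  elim: rG fG {IH} => [|B j G' N'' rB _ IHG] /=; first by constructor.
  move=> [fB fG]; apply: Forall2_cons; last exact: IHG.
  by apply: reads_ren rB => v fv; apply: f'E => vy; subst v.
elim=> {S As}.
- move=> S G G' p _ IH noY f N /(Permutation_Forall2 (Permutation_sym p)) [N' [pN rG]].
  exact: igood_perm (Permutation_sym pN) (IH noY f N' rG).
- move=> S x t _ noY f N HF; have [i [N1 [-> ri]]] := Forall2_consE HF.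
  move=> HF'; have [j [N2 [-> rj /Forall2_nilE ->]]] := Forall2_consE HF'.
  rewrite (reads_inv ri) (reads_inv rj).
  apply: (igood_act (M := [::]) (iact_cut _ _ _ _) (Permutation_refl _)) => _ <-.
  exact: igood_nil.
- move=> S _ noY f N HF; have [i [N1 [-> r /Forall2_nilE ->]]] := Forall2_consE HF.
  rewrite (reads_inv r).
  exact: igood_step (iact_nil _) (igood_nil _).
- move=> S G A B _ _ IH noY f N HF; have [i [N1 [-> r rG]]] := Forall2_consE HF.
  have [P [Q [-> rA rB]]] := reads_inv r.
  apply: igood_step (iact_par P Q) _; apply: (IH noY f).
  by do 2!apply: Forall2_cons => //.
- by move=> S S1 S2 G D A B _ _ _ _ _ _ _ f N HF; have [i [N1 [_ r _]]] := Forall2_consE HF;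
  have := reads_inv r.
- move=> S S1 S2 G D _ J _ IH1 _ IH2 /(store_join_noYa J) [noY1 noY2] f N.
  move=> /Forall2_cat_inv [N1 [N2 [-> r1 r2]]].
  (* Mix is grafting with nothing attached: [N2] simply waits beside the schedule of [N1]. *)
  apply: (@igood_graft_plain _ [::] N1 N2) => //.
    exact: IH1 noY1 _ _ r1.
  exact: IH2 noY2 _ _ r2.
- move=> S G n n0 A k _ _ IH noY f N.
  move=> HF; have [i [N1 [-> r0 rG]]] := Forall2_consE HF.
  have [x [L [L0 [P [-> rP]]]]] := reads_inv r0.
  have [l [hl r]] := rP k.
  apply: igood_step (iact_bra x L0 P hl) _; apply: (IH noY f).
  exact: Forall2_cons.
- move=> S G n n0 A _ _ IH noY f N.
  move=> HF; have [i [N1 [-> r0 rG]]] := Forall2_consE HF.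
  have [x [L [L0 [P [-> rP]]]]] := reads_inv r0.
  apply: (igood_act (iact_sel x L0 P) (Permutation_refl _)) => _ [k [hk <-]].
  have [j r] := rP k hk; rewrite map_iren_id //; apply: (IH j noY f).
  exact: Forall2_cons.
- by move=> S G A y _ _ _ _ _ f N HF; have [i [N1 [_ r _]]] := Forall2_consE HF;
  have := reads_inv r.
- move=> S G A y _ _ IH noY f N.
  move=> HF; have [i [N1 [-> r rG]]] := Forall2_consE HF.
  have [x [P [-> rP]]] := reads_inv r.
  apply: igood_step (iact_in x (f y) P) _; apply: (IH noY f).
  exact: Forall2_cons.
- move=> S S1 S2 G D A B C F _ J _ IH1 _ IH2 /(store_join_noYa J) [noY1 noY2] f N.
  move=> HF; have [i [N1 [-> r]]] := Forall2_consE HF.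
  have [o [x [t [P [rA rB ig]]]]] := reads_inv r.
  move=> HF'; have [i' [N2 [-> r']]] := Forall2_consE HF'.
  have [o' [x' [t' [P' [rC rF ig']]]]] := reads_inv r'.
  move=> /Forall2_cat_inv [NG [ND [-> rG rD]]].
  apply: ig; apply: igood_perm (Permutation.perm_swap _ _ _) _; apply: ig'.
  apply: igood_perm (Permutation.perm_swap _ _ _) _.
  (* The left premise schedules the bare atoms with [NG]; the right one schedules what they guard
     with [ND]. *)
  apply: (@igood_graft_plain _
    [:: (IAct o x t [::], [:: P]); (IAct o' x' t' [::], [:: P'])] NG ND).
  + by do 2!constructor=> //.
  + by apply: (IH1 noY1 f); do 2!apply: Forall2_cons => //.
  + by apply: (IH2 noY2 f); do 2!apply: Forall2_cons => //.
- move=> S S1 S2 G D A B _ J _ IH1 _ IH2 /(store_join_noYa J) [noY1 noY2] f N.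
  move=> HF; have [i [N1 [-> r]]] := Forall2_consE HF.
  have [o [x [t [P [rA rB ig]]]]] := reads_inv r.
  move=> /Forall2_cat_inv [NG [ND [-> rG rD]]]; apply: ig.
  apply: (@igood_graft_plain _ [:: (IAct o x t [::], [:: P])] NG ND).
  + by constructor.
  + by apply: (IH1 noY1 f); apply: Forall2_cons.
  + by apply: (IH2 noY2 f); apply: Forall2_cons.
- move=> q S G A y _ fr _ IH noY f N; apply: nu fr _ => _.
  exact: IH noY.
- move=> q S S' G A y _ fr J _ IH noY f N; apply: nu fr _ => qN; subst q.
  apply: IH => v; case: (J v) => -[E1 E2]; rewrite E2 //.
  by rewrite /store1; case: eqP.
- move=> q S S' G A y _ J _ _ noY f N HF; have [i [N1 [_ r _]]] := Forall2_consE HF.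
  have [qN _] := reads_inv r.
  case: (J y) => -[]; rewrite /store1 eqxx // => _ Sy.
  by case: (noY y); rewrite Sy; case: (q) qN.
Qed.

Lemma provable_good (Lab : finType) (E : countType) R (P : proc Lab) :
  provable_with R (tr E P) -> good true [:: P].
Proof.
(* Variables of [E] are absent from the translation but may serve as existential witnesses. Since
   [f] may identify variables, 0 is a harmless default for them. *)
move=> p; pose f (v : var E) : name := if v is inl n then n else 0.
have frE : tr E P = fren id (tr E P).
  have -> : id = @vren E id by apply: functional_extensionality => -[].
  by rewrite -tr_ren ren_id.
have r : reads f (tr E P) (IProc P).
  by rewrite frE -[X in IProc X]ren_id; apply: (reads_proc f id).
apply: (@igood_good _ [:: IProc P]).
  by apply: (pil_igood p _ (f := f)) => //; apply: Forall2_cons.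
by apply: Forall2_cons; first exact: real_proc.
Qed.

Lemma good_provable (Lab : finType) (E : countType) (P : proc Lab) :
  good true [:: P] -> provable_with process_rules (tr E P).
Proof.
move=> g; have [||//] := @good_pil _ E _ g (vren id) [:: tr E P]; last by [].
by apply: Forall2_cons => //; left; rewrite -tr_ren ren_id.
Qed.

Lemma pil_mono (Lab : finType) (E : countType) (R R' : rule -> bool) (S : store E)
  (As : seq (form Lab E)) : (forall r, R r -> R' r) -> pil R S As -> pil R' S As.
Proof.
move=> RR'; elim; intros;
  [eapply pil_exch|apply: pil_ax|apply: pil_unit|apply: pil_par|eapply pil_tens
  |eapply pil_mix|eapply pil_plus|apply: pil_with|eapply pil_all|eapply pil_ex
  |eapply pil_prec|eapply pil_precO|eapply pil_nomO|eapply pil_nomLoad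
  |eapply pil_nomPop]; eauto.
Qed.

Theorem theorem3 (Lab : finType) (E : countType) (P : proc Lab) :
  race_free P ->
  (deadlock_free P <-> provable (tr E P)) /\
  (deadlock_free P <-> provable_with process_rules (tr E P)).
Proof.
move=> rf.
(* Soundness for an arbitrary rule set gives both converse implications; completeness is only needed
   for the small one. *)
have pg R : provable_with R (tr E P) -> deadlock_free P.
  by move=> /provable_good; apply: good_deadlock_free.
have gp : deadlock_free P -> provable_with process_rules (tr E P).
  by move=> df; apply/good_provable/(deadlock_free_good (k := 0) df)/structs_refl.
split; split=> [df|]; [|exact: pg|exact: gp|exact: pg].
exact: (@pil_mono _ _ process_rules) (gp df).
Qed.
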